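(* Let $q$ be an odd prime power. Then $$\mathcal{C}_q\subseteq\{\Theta\in\mathbb{I}_q: m_t(\Theta)\ge q^{-2(q-1)}\}\subseteq E_q^{(t)}.$$ Furthermore, with $A_q=\frac{q-1}{2}\log_2(q-1)$, $$0<\mathcal{H}^{h_{A_q}}(\mathcal{C}_q)<\infty,$$ and $$\mathcal{H}^{h_A}(E_q^{(t)})=\infty\qquad\text{for every } 0<A\le A_q.$$ In particular, $\dim_{\log}E_q^{(t)}\ge A_q$.
   Context: $\mathbb{F}_q$ is the field with $q$ elements and $\mathbb{F}_q((t^{-1}))$ the field of formal Laurent series in $t^{-1}$. For non-zero $\Gamma=\sum_{j\ge -j_0}c_jt^{-j}$ with $c_{-j_0}\ne0$, put $\deg\Gamma=j_0$, $|\Gamma|=q^{\deg\Gamma}$; also $|0|=0$. The fractional part is $\langle\Gamma\rangle=\sum_{j\ge1}c_jt^{-j}$. Let $\mathbb{I}_q=t^{-1}\mathbb{F}_q[[t^{-1}]]$, with the ultrametric $d(\Theta,\Phi)=|\Theta-\Phi|$. For non-zero $Q\in\mathbb{F}_q[t]$ let $v_t(Q)=\max\{k\ge0:t^k\mid Q\}$ and $|Q|_t=q^{-v_t(Q)}$. For $\Theta\in\mathbb{I}_q$ let $$m_t(\Theta)=\inf_{0\ne Q\in\mathbb{F}_q[t]}|Q|\,|Q|_t\,|\langle Q\Theta\rangle|,\qquad E_q^{(t)}=\{\Theta\in\mathbb{I}_q:m_t(\Theta)>0\}.$$ Put $d=(q-1)/2$ and $Z=\{\zeta\in\mathbb{F}_q^\times:\zeta^d=-1\}$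 (the quadratic non-residues of $\mathbb{F}_q$). For a collection $\mathbf a=(a_{k,\zeta})_{k\ge0,\,\zeta\in Z}$ with all $a_{k,\zeta}\in\mathbb{F}_q^\times$, let $$\Lambda_{\mathbf a}(t)=\sum_{k=0}^\infty\sum_{\zeta\in Z}a_{k,\zeta}\frac{t^{2^k}}{t^{2^{k+1}}-\zeta}\in\mathbb{I}_q,$$ where each fraction is expanded as a Laurent series in $t^{-1}$ (the series converges since each summand of the $k$th block has absolute value $q^{-2^k}$). Let $\mathcal{C}_q$ be the set of all $\Lambda_{\mathbf a}$, with $\mathbf a$ ranging over all such collections. For a gauge function $h$ (continuous non-decreasing $h:[0,\infty)\to[0,\infty)$ with $h(0)=0$ and $h(r)>0$ for $r>0$), a subset $E$ of a metric space and $\delta>0$, $\mathcal{H}^h_\delta(E)=\inf\{\sum_i h(\operatorname{diam}U_i): E\subseteq\bigcup_i U_i,\ \operatorname{diam}U_i\le\delta\}$, the infimum being over countable covers, and $\mathcal{H}^h(E)=\lim_{\delta\to0}\mathcal{H}^h_\delta(E)$. For $s>0$, $h_s$ is the gauge $h_s(r)=1/(\log(1/r))^s$ for $0<r<e^{-1}$, $h_s(0)=0$, extended away from zero in any continuous non-decreasing way. The logarithmic Hausdorff dimension is $\dim_{\log}E=\inf\{s>0:\mathcal{H}^{h_s}(E)=0\}$ (with $\inf\emptyset=+\infty$). *)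

(* Defs.v *)
From HB Require Import structures.
From mathcomp Require Import all_boot all_order all_algebra.
From mathcomp Require Import all_classical all_reals all_analysis.
From mathcomp Require Import zify ring lra.

Set Implicit Arguments.
Unset Strict Implicit.
Unset Printing Implicit Defensive.

Import Order.TTheory GRing.Theory Num.Theory.
Import numFieldNormedType.Exports.

Local Open Scope classical_set_scope.
Local Open Scope ring_scope.

(* A formal Laurent series in t^-1: [coefl f n] is the coefficient of t^n,
   and all coefficients of large enough exponent vanish. *)
Record laurent (F : fieldType) := Laurent {
  coefl : int -> F;
  coefl_bounded : `[< exists N : int, forall n, N < n -> coefl n = 0 >] }.

HB.instance Definition _ (F : fieldType) := [isSub for @coefl F].
HB.instance Definition _ (F : fieldType) := [Choice of laurent F by <:].

Section LaurentField.
Variable F : fieldType.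
Implicit Types (f g h : laurent F) (A B n : int).

Definition degle f A := forall n, A < n -> coefl f n = 0.

Lemma laurent_degle f : exists A, degle f A.
Proof. by have /asboolP := coefl_bounded f. Qed.

Lemma degleW f A B : A <= B -> degle f A -> degle f B.
Proof. by move=> AB fA n Bn; apply: fA; apply: le_lt_trans Bn. Qed.

Lemma laurent_degle2 f g : exists A, degle f A /\ degle g A.
Proof.
have [A fA] := laurent_degle f; have [B gB] := laurent_degle g.
exists (Num.max A B); split.
  by apply: degleW fA; rewrite le_max lexx.
by apply: degleW gB; rewrite le_max lexx orbT.
Qed.

Lemma laurentP f g : (forall n, coefl f n = coefl g n) -> f = g.
Proof. by move=> fg; apply: val_inj; apply/funext. Qed.

Fact zerol_subproof :
  `[< exists N : int, forall n, N < n -> (fun=> 0 : F) n = 0 >].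
Proof. by apply/asboolP; exists 0. Qed.
Definition zerol := Laurent zerol_subproof.

Fact addl_subproof f g :
  `[< exists N : int, forall n, N < n -> coefl f n + coefl g n = 0 >].
Proof.
have [A [fA gA]] := laurent_degle2 f g.
by apply/asboolP; exists A => n An; rewrite fA// gA// addr0.
Qed.
Definition addl f g := Laurent (addl_subproof f g).

Fact oppl_subproof f :
  `[< exists N : int, forall n, N < n -> - coefl f n = 0 >].
Proof.
have [A fA] := laurent_degle f.
by apply/asboolP; exists A => n An; rewrite fA// oppr0.
Qed.
Definition oppl f := Laurent (oppl_subproof f).

Fact addlA : associative addl.
Proof. by move=> f g h; apply: laurentP => n /=; rewrite addrA. Qed.
Fact addlC : commutative addl.
Proof. by move=> f g; apply: laurentP => n /=; rewrite addrC. Qed.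
Fact add0l : left_id zerol addl.
Proof. by move=> f; apply: laurentP => n /=; rewrite add0r. Qed.
Fact addNl : left_inverse zerol oppl addl.
Proof. by move=> f; apply: laurentP => n /=; rewrite addNr. Qed.

HB.instance Definition _ :=
  GRing.isZmodule.Build (laurent F) addlA addlC add0l addNl.

Lemma coefl0 n : coefl (0 : laurent F) n = 0. Proof. by []. Qed.
Lemma coeflD f g n : coefl (f + g) n = coefl f n + coefl g n.
Proof. by []. Qed.
Lemma coeflN f n : coefl (- f) n = - coefl f n. Proof. by []. Qed.
Lemma coeflB f g n : coefl (f - g) n = coefl f n - coefl g n.
Proof. by []. Qed.

Lemma convl_finite (c d : int -> F) A B n (s : seq int) :
    (forall i, A < i -> c i = 0) -> (forall i, B < i -> d i = 0) ->
    uniq s -> (forall i, n - B <= i <= A -> i \in s) ->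
  \sum_(i \in [set: int]) c i * d (n - i) = \sum_(i <- s) c i * d (n - i).
Proof.
move=> cA dB us sP; rewrite (fsbigE s)//; first by under eq_bigl do rewrite in_setT.
move=> i _ /(contra (sP i)); rewrite negb_and -!ltNge => /orP[iB|/cA->].
  by rewrite [d _]dB ?mulr0//; lia.
by rewrite mul0r.
Qed.

Fact mull_subproof f g : `[< exists N : int, forall n, N < n ->
  \sum_(i \in [set: int]) coefl f i * coefl g (n - i) = 0 >].
Proof.
have [A fA] := laurent_degle f; have [B gB] := laurent_degle g.
apply/asboolP; exists (A + B) => n ABn.
rewrite (convl_finite (s := [::]) fA gB) ?big_nil// => i; lia.
Qed.
(* The Cauchy product; the sum over all integers has finite support. *)
Definition mull f g := Laurent (mull_subproof f g).

Fact onel_subproof :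
  `[< exists N : int, forall n, N < n -> (n == 0)%:R = 0 :> F >].
Proof. by apply/asboolP; exists 0 => n; case: eqP => // ->. Qed.
Definition onel := Laurent onel_subproof.

Definition truncl A k f : {poly F} := \poly_(i < k) coefl f (A - i%:Z).

Lemma coefl_trunc f A k n : degle f A -> A < n + k%:Z ->
  coefl f n = if n <= A then (truncl A k f)`_`|A - n|%N else 0.
Proof.
move=> fA nk; case: (leP n A) => [nA|/fA//].
rewrite coef_poly ifT; last by lia.
by congr coefl; lia.
Qed.

Lemma coefl_mul f g A B K k : degle f A -> degle g B -> (k < K)%N ->
  coefl (mull f g) (A + B - k%:Z) = (truncl A K f * truncl B K g)`_k.
Proof.
move=> fA gB kK.
rewrite /= (convl_finite (s := [seq A - i%:Z | i <- iota 0 k.+1]) fA gB).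
- rewrite big_map coefM -(big_mkord xpredT (fun i => _`_i * _`_(k - i))).
  rewrite /index_iota subn0 big_seq_cond [RHS]big_seq_cond.
  apply: eq_bigr => i; rewrite andbT mem_iota add0n => /andP[_ ik].
  rewrite !coef_poly !ifT; [|lia|lia].
  by congr (_ * coefl g _); lia.
- by rewrite map_inj_uniq ?iota_uniq// => i j; lia.
- move=> i iP; apply/mapP; exists `|A - i|%N; last by lia.
  by rewrite mem_iota; lia.
Qed.

Lemma degle_mul f g A B : degle f A -> degle g B -> degle (mull f g) (A + B).
Proof.
move=> fA gB n ABn /=.
by rewrite (convl_finite (s := [::]) fA gB) ?big_nil// => i; lia.
Qed.

Lemma degle_eq f g A : degle f A -> degle g A ->
  (forall k : nat, coefl f (A - k%:Z) = coefl g (A - k%:Z)) -> f = g.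
Proof.
move=> fA gA fg; apply: laurentP => n; case: (leP n A) => [nA|An].
  by have -> : n = A - `|A - n|%N%:Z by lia.
by rewrite fA// gA.
Qed.

Lemma degle_add f g A : degle f A -> degle g A -> degle (f + g) A.
Proof. by move=> fA gA n An; rewrite coeflD fA// gA// addr0. Qed.

Lemma coefl_truncl A K f k : (k < K)%N -> (truncl A K f)`_k = coefl f (A - k%:Z).
Proof. by move=> kK; rewrite coef_poly kK. Qed.

Fact mullC : commutative mull.
Proof.
move=> f g; have [A [fA gA]] := laurent_degle2 f g.
apply: (degle_eq (A := A + A)); [exact: degle_mul|exact: degle_mul|].
by move=> k; rewrite !(coefl_mul (K := k.+1))// mulrC.
Qed.

Lemma coef_mul_congr (p p' r : {poly F}) k :
  (forall i, (i <= k)%N -> p`_i = p'`_i) -> (p * r)`_k = (p' * r)`_k.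
Proof.
move=> pp'; rewrite !coefM; apply: eq_bigr => i _.
by rewrite pp'// -ltnS ltn_ord.
Qed.

Fact mullA : associative mull.
Proof.
move=> f g h; have [A fA] := laurent_degle f.
have [B gB] := laurent_degle g; have [C hC] := laurent_degle h.
apply: (degle_eq (A := A + B + C)).
- by rewrite -addrA; apply: degle_mul => //; apply: degle_mul.
- by apply: degle_mul => //; apply: degle_mul.
move=> k; rewrite (coefl_mul (K := k.+1) (degle_mul fA gB) hC)//.
rewrite -[A + B + C]addrA (coefl_mul (K := k.+1) fA (degle_mul gB hC))//.
rewrite [in LHS]mulrC.
transitivity (truncl B k.+1 g * truncl C k.+1 h * truncl A k.+1 f)`_k.
  apply: coef_mul_congr => i ik.
  by rewrite coefl_truncl// (coefl_mul (K := k.+1)).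
transitivity (truncl A k.+1 f * truncl B k.+1 g * truncl C k.+1 h)`_k.
  by rewrite mulrC mulrA.
apply: coef_mul_congr => i ik.
by rewrite coefl_truncl// (coefl_mul (K := k.+1)).
Qed.

Lemma degle_one : degle onel 0.
Proof. by move=> n /=; case: eqP => // ->. Qed.

Fact mul1l : left_id onel mull.
Proof.
move=> f; have [A fA] := laurent_degle f.
apply: (degle_eq (A := 0 + A)); first exact: degle_mul degle_one fA.
  by rewrite add0r.
move=> k; rewrite (coefl_mul (K := k.+1) degle_one fA)//.
transitivity (1 * truncl A k.+1 f)`_k; last first.
  by rewrite mul1r coefl_truncl// add0r.
apply: coef_mul_congr => i ik; rewrite coefl_truncl// coef1 /=.
by congr (_%:R); lia.
Qed.

Fact mullDl : left_distributive mull addl.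
Proof.
move=> f g h; have [A [fA gA]] := laurent_degle2 f g.
have [B hB] := laurent_degle h.
have fgA : degle (addl f g) A := degle_add fA gA.
apply: (degle_eq (A := A + B)); first exact: degle_mul.
  by apply: degle_add; apply: degle_mul.
move=> k; rewrite (coefl_mul (K := k.+1) fgA hB)//.
rewrite coeflD !(coefl_mul (K := k.+1) _ hB)// -coefD -mulrDl.
by apply: coef_mul_congr => i ik; rewrite coefD !coefl_truncl.
Qed.

Fact onel_neq0 : onel != 0.
Proof.
apply/eqP => /(congr1 (fun f : laurent F => coefl f 0%Z)) /eqP.
by rewrite /= oner_eq0.
Qed.

HB.instance Definition _ := GRing.Zmodule_isComNzRing.Build (laurent F)
  mullA mullC mul1l mullDl onel_neq0.

Lemma coefl1 n : coefl (1 : laurent F) n = (n == 0)%:R. Proof. by []. Qed.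
Lemma coeflM f g n : coefl (f * g) n =
  \sum_(i \in [set: int]) coefl f i * coefl g (n - i).
Proof. by []. Qed.

Lemma laurent_top f : f != 0 -> exists A, coefl f A != 0 /\ degle f A.
Proof.
move=> f0; have [A fA] := laurent_degle f.
have exk : exists k : nat, coefl f (A - k%:Z) != 0.
  apply/not_existsP => /= fk0; move/eqP: f0; apply.
  apply: (degle_eq fA) => // k; apply/eqP/negPn/negP; exact: fk0.
exists (A - (ex_minn exk)%:Z); case: ex_minnP => k fk kmin; split=> // n kn.
case: (leP n A) => [nA|/fA//]; apply/eqP/negPn/negP => fn.
suff : (k <= `|A - n|)%N by lia.
by apply: kmin; have <- : n = A - `|A - n|%N%:Z by lia.
Qed.

Fixpoint invl_seq (c : nat -> F) (k : nat) : seq F :=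
  if k is k'.+1 then
    let s := invl_seq c k' in
    rcons s ((c 0%N)^-1 * ((k' == 0%N)%:R - \sum_(i < k') c (k' - i)%N * s`_i))
  else [::].

Lemma size_invl_seq c k : size (invl_seq c k) = k.
Proof. by elim: k => //= k IHk; rewrite size_rcons IHk. Qed.

Lemma nth_invl_seq c k i : (i < k)%N ->
  (invl_seq c k)`_i = (invl_seq c i.+1)`_i.
Proof.
elim: k => // k IHk; rewrite ltnS leq_eqVlt => /predU1P[-> //|ik].
by rewrite [LHS]/= nth_rcons size_invl_seq ik IHk.
Qed.

Lemma invl_seqP (c : nat -> F) k : c 0%N != 0 ->
  \sum_(i < k.+1) c (k - i)%N * (invl_seq c i.+1)`_i = (k == 0%N)%:R.
Proof.
move=> c0; rewrite big_ord_recr/= subnn nth_rcons size_invl_seq ltnn eqxx.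
rewrite mulrA mulfV// mul1r addrC.
rewrite (eq_bigr (fun i : 'I_k => c (k - i)%N * (invl_seq c i.+1)`_i)).
  by rewrite subrK.
by move=> i _; rewrite nth_invl_seq.
Qed.

Fact invl_subproof A (u : nat -> F) : `[< exists N : int, forall n, N < n ->
  (if n <= A then u `|A - n|%N else 0) = 0 >].
Proof. by apply/asboolP; exists A => n; rewrite ltNge => /negPf->. Qed.

Lemma invl_ex f : f != 0 -> exists g, g * f = 1.
Proof.
move=> /laurent_top[A [fA0 fA]].
pose c (k : nat) := coefl f (A - k%:Z).
have c0 : c 0%N != 0 by rewrite /c subr0.
pose u k := (invl_seq c k.+1)`_k.
pose g := Laurent (invl_subproof (- A) u).
have gA : degle g (- A) by move=> n; rewrite /= ltNge => /negPf->.
exists g; apply: (degle_eq (A := - A + A)); first exact: degle_mul.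
  by rewrite addNr; exact: degle_one.
move=> k; rewrite (coefl_mul (K := k.+1) gA fA)// coefl1.
have -> : (- A + A - k%:Z == 0) = (k == 0%N) by apply/eqP/eqP; lia.
rewrite -(invl_seqP k c0) coefM; apply: eq_bigr => i _.
have ik := ltn_ord i.
rewrite !coefl_truncl; [|lia|lia].
rewrite mulrC; congr (_ * _); rewrite /= ifT; last by lia.
by rewrite /u; congr (invl_seq c _.+1)`_ _; lia.
Qed.

Definition invl f : laurent F := xget 0 [set g | g * f = 1].

Fact mulVl f : f != 0 -> invl f * f = 1.
Proof.
move=> /invl_ex ex; rewrite /invl; case: xgetP => // ne.
by case: ex => g /ne.
Qed.

Fact invl0 : invl 0 = 0.
Proof.
rewrite /invl; case: xgetP => // g _ /=; rewrite mulr0 => /eqP.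
by rewrite eq_sym oner_eq0.
Qed.

HB.instance Definition _ := GRing.ComNzRing_isField.Build (laurent F) mulVl invl0.

End LaurentField.

Section LaurentPoly.
Variable F : fieldType.

Fact polyl_subproof (p : {poly F}) : `[< exists N : int, forall n, N < n ->
  (if n is Posz k then p`_k else 0) = 0 >].
Proof.
apply/asboolP; exists (size p)%:Z => -[k pk|//].
by rewrite nth_default// ltnW.
Qed.
Definition polyl p := Laurent (polyl_subproof p).

Fact fracl_subproof (f : laurent F) : `[< exists N : int, forall n, N < n ->
  (if n < 0 then coefl f n else 0) = 0 >].
Proof. by apply/asboolP; exists 0 => n n0; rewrite ltNge (ltW n0). Qed.
Definition fracl f := Laurent (fracl_subproof f).

Fact polyl_zmod_morphism : zmod_morphism polyl.
Proof.
by move=> p r; apply: laurentP => -[k|k]; rewrite coeflB /= ?coefB ?subr0.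
Qed.
HB.instance Definition _ := GRing.isZmodMorphism.Build {poly F} (laurent F)
  polyl polyl_zmod_morphism.

Fact polyl_monoid_morphism : monoid_morphism polyl.
Proof.
split; first by apply: laurentP => -[[|k]|k]; rewrite coefl1/= ?coef1.
move=> p r; apply: laurentP => -[k|k]; rewrite coeflM; last first.
  rewrite fsbig1// => -[i|i] _ /=; last by rewrite mul0r.
  have -> : Negz k - i%:Z = Negz (k + i)%N by rewrite !NegzE; lia.
  by rewrite mulr0.
rewrite (fsbigE [seq i%:Z | i <- iota 0 k.+1])//.
- rewrite big_map /= coefM -(big_mkord xpredT (fun i => p`_i * r`_(k - i))).
  rewrite /index_iota subn0; under [RHS]eq_bigl do rewrite in_setT.
  rewrite big_seq_cond [RHS]big_seq_cond.
  apply: eq_bigr => i; rewrite andbT mem_iota add0n => /andP[_ ik].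
  by have -> : k%:Z - i%:Z = (k - i)%N%:Z by lia.
- by rewrite map_inj_uniq ?iota_uniq// => i j [].
- move=> [i|i] _; last by rewrite mul0r.
  rewrite mem_map; last by move=> ? ? [].
  rewrite mem_iota add0n /= -leqNgt => ki.
  have -> : k%:Z - i%:Z = Negz (i - k.+1)%N by rewrite NegzE; lia.
  by rewrite mulr0.
Qed.
HB.instance Definition _ := GRing.isMonoidMorphism.Build {poly F} (laurent F)
  polyl polyl_monoid_morphism.
End LaurentPoly.

Section LaurentAbs.
Variables (R : realType) (F : finFieldType).
Implicit Types f g : laurent F.

Definition degl f : int := xget 0 [set n | coefl f n != 0 /\ degle f n].

Definition absl f : R := if f == 0 then 0 else #|F|%:R ^ degl f.

Lemma deglP f : f != 0 -> coefl f (degl f) != 0 /\ degle f (degl f).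
Proof.
by move=> /laurent_top[A fA]; rewrite /degl; case: xgetP => [n -> //|/(_ A)].
Qed.

Lemma absl0 : absl 0 = 0. Proof. by rewrite /absl eqxx. Qed.

Let q_gt1 : 1 < #|F|%:R :> R.
Proof. by rewrite ltr1n; exact: card_finNzRing_gt1. Qed.

Let q_gt0 : 0 < #|F|%:R :> R. Proof. exact: lt_trans q_gt1. Qed.

Lemma absl_ge0 f : 0 <= absl f.
Proof. by rewrite /absl; case: ifP => // _; rewrite exprz_ge0// ltW. Qed.

Lemma absl_eq0 f : (absl f == 0) = (f == 0).
Proof.
rewrite /absl; case: ifP => [|_]; first by rewrite eqxx.
by rewrite expfz_eq0 (gt_eqF q_gt0) andbF.
Qed.

Lemma absl_le f A : (absl f <= #|F|%:R ^ A) <-> degle f A.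
Proof.
rewrite /absl; have [->|f0] := eqVneq f 0.
  by rewrite exprz_ge0 1?ltW.
have [fd df] := deglP f0; rewrite ler_eXz2l//; split.
  by move=> dA; apply: degleW df.
by move=> fA; rewrite leNgt; apply: contra fd => /fA->.
Qed.

Lemma abslN f : absl (- f) = absl f.
Proof.
have le_abslN f' : absl (- f') <= absl f'.
  have [->|f0] := eqVneq f' 0; first by rewrite oppr0.
  rewrite [leRHS]/absl (negPf f0); apply/absl_le => n nf.
  by rewrite coeflN (deglP f0).2// oppr0.
by apply/eqP; rewrite eq_le le_abslN -{1}[f]opprK le_abslN.
Qed.

Lemma absl_add f g : absl (f + g) <= Num.max (absl f) (absl g).
Proof.
have [->|f0] := eqVneq f 0; first by rewrite add0r le_max lexx orbT.
have [->|g0] := eqVneq g 0; first by rewrite addr0 le_max lexx.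
wlog fg : f g f0 g0 / absl f <= absl g.
  move=> W; case/orP: (le_total (absl f) (absl g)) => fg; first exact: W.
  by rewrite addrC maxC; apply: W.
rewrite le_max; apply/orP; right.
move: fg; rewrite {2 4}/absl (negPf g0) => /absl_le fg; apply/absl_le.
by apply: degle_add => //; exact: (deglP g0).2.
Qed.

End LaurentAbs.

(* [laurent F] with the distance |f - g|; the parameter [R] fixes the real type
   in which the distance takes its values. *)
Definition laurent_space (R : realType) (F : finFieldType) : Type := laurent F.

Section LaurentMetric.
Variables (R : realType) (F : finFieldType).
Implicit Types f g h : laurent_space R F.

HB.instance Definition _ := GRing.Field.on (laurent_space R F).

Definition distl f g : R := absl R (f - g).

Fact distll f : distl f f = 0.
Proof. by rewrite /distl subrr absl0. Qed.

Fact distl_positivity f g : distl f g = 0 -> f = g.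
Proof. by move=> /eqP; rewrite absl_eq0 subr_eq0 => /eqP. Qed.

Fact distl_sym f g : distl f g = distl g f.
Proof. by rewrite /distl -opprB abslN. Qed.

Fact distl_triangle g f h : distl f h <= distl f g + distl g h.
Proof.
rewrite /distl -[f - h](subrKA g); apply: le_trans (absl_add _ _ _) _.
by rewrite ge_max lerDl lerDr !absl_ge0.
Qed.

HB.instance Definition _ := isMetric.Build R (laurent_space R F)
  distll distl_positivity distl_sym distl_triangle.
HB.instance Definition _ := isPointed.Build (laurent_space R F) 0.

End LaurentMetric.

Section Hausdorff.
Variables (R : realType) (T : metricType R).
Implicit Types (U E : set T) (h : R -> R).
Local Open Scope ereal_scope.

(* The maximum with 0 only matters for the empty set, whose diameter is 0. *)
Definition diam U : \bar R :=
  maxe 0 (ereal_sup [set (mdist p.1 p.2)%:E | p in U `*` U]).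

Definition hausdorff_delta h (delta : R) E : \bar R :=
  ereal_inf [set \sum_(i <oo) (h (fine (diam (U i))))%:E
            | U in [set U : (set T)^nat | E `<=` \bigcup_i U i /\
                                          forall i, diam (U i) <= delta%:E]].

Definition hausdorff_measure h E : \bar R :=
  lim (hausdorff_delta h delta E @[delta --> (0%R : R)^'+]).

(* [h s] is the gauge used for the exponent [s]. *)
Definition dim_log (h : R -> R -> R) E : \bar R :=
  ereal_inf [set s%:E
            | s in [set s : R | (0 < s)%R /\ hausdorff_measure (h s) E = 0]].

End Hausdorff.

(* Gauges are only constrained on [0, +oo[. *)
Definition gauge (R : realType) (h : R -> R) : Prop :=
  [/\ {within `[0, +oo[, continuous h},
      {in `[0, +oo[ &, {homo h : x y / x <= y}},
      h 0 = 0 & forall r : R, 0 < r -> 0 < h r].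

(* [h] is one of the admissible extensions of [h_s]. *)
Definition log_gauge (R : realType) (s : R) (h : R -> R) : Prop :=
  gauge h /\ forall r : R, 0 < r < expR (- 1) -> h r = 1 / (ln (1 / r) `^ s).

(* Such extensions exist, so assuming a choice of them is harmless. *)
Lemma log_gauge_ex (R : realType) (s : R) : 0 < s -> exists h, log_gauge s h.
Proof.
move=> s0; pose M (r : R) := Num.max 1 (- ln r).
pose g r := expR (- (s * ln (M r))).
pose h r := if 0 < r then g r else 0.
have M1 r : 1 <= M r by rewrite le_max lexx.
have M0 r : 0 < M r by exact: lt_le_trans (M1 r).
have hg r : 0 < r -> h r = g r by rewrite /h => ->.
have g_homo x y : 0 < x -> x <= y -> g x <= g y.
  move=> x0 xy; have y0 : 0 < y by exact: lt_le_trans xy.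
  rewrite /g ler_expR lerN2 ler_pM2l// ler_ln ?posrE// /M.
  rewrite ge_max !le_max lexx /= lerN2 ler_ln ?posrE// xy orbT//.
exists h; split; last first.
  move=> r /andP[r0 re].
  have lnr : ln r < -1 by rewrite -(expRK (-1)) ltr_ln ?posrE// expR_gt0.
  rewrite hg// /g /M max_r; last by lra.
  rewrite !div1r lnV ?posrE//.
  by rewrite /powR gt_eqF ?expRN//; lra.
split.
- apply/continuous_within_itvcyP; split.
    move=> x; rewrite in_itv /= andbT => x0.
    have : {for x, continuous g}.
      have cM : {for x, continuous M}.
        apply: (@continuous_max _ _ (cst 1)); first exact: cst_continuous.
        exact: (continuousN (continuous_ln x0)).
      have cl : {for x, continuous (@ln R \o M)}.
        by apply: continuous_comp => //; exact: continuous_ln.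
      have csl : {for x, continuous (cst s \* (@ln R \o M))}.
        by apply: (@continuousM R _ (cst s)) => //; exact: cst_continuous.
      have cN := continuousN csl.
      by apply: (continuous_comp cN); exact: continuous_expR.
    move=> cg; rewrite /prop_for /continuous_at (hg x x0).
    apply: cvg_trans cg; apply: near_eq_cvg; near=> y.
    by rewrite hg//; near: y; exact: lt_nbhsr.
  have -> : h 0 = 0 by rewrite /h ltxx.
  apply/cvgrPdist_le => e e0.
  pose L := expR (- (ln e / s)).
  near=> r.
  have r0 : 0 < r by near: r; exact: nbhs_right_gt.
  have rL : r < expR (- L) by near: r; apply: nbhs_right_lt; exact: expR_gt0.
  rewrite sub0r normrN hg// gtr0_norm ?expR_gt0//.
  rewrite -[leRHS]lnK ?posrE// ler_expR lerNl.
  have LM : L <= M r.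
    rewrite le_max; apply/orP; right.
    by rewrite lerNr -(expRK (- L)) ler_ln ?posrE ?expR_gt0// ltW.
  have : ln L <= ln (M r) by rewrite ler_ln ?posrE// expR_gt0.
  rewrite /L expRK => LL.
  have := ler_wpM2l (ltW s0) LL.
  by apply: le_trans; rewrite mulrN mulrCA divff ?mulr1// gt_eqF.
- move=> x y; rewrite !in_itv /= !andbT => x0 y0 xy.
  rewrite /h; case: ltP => [x1|_]; first by rewrite (lt_le_trans x1 xy); exact: g_homo.
  by case: ifP => // _; exact: expR_ge0.
- by rewrite /h ltxx.
- by move=> r r0; rewrite hg//; exact: expR_gt0.
Unshelve. all: by end_near. Qed.

Section Problem.
Variables (R : realType) (F : finFieldType).
Implicit Types (Q : {poly F}) (Theta : laurent_space R F).

(* The subset t^-1 F[[t^-1]] of F((t^-1)). Covers of its subsets are taken in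
   F((t^-1)); intersecting them with [I_q] does not increase diameters, so this
   gives the Hausdorff measures of the metric space [I_q]. *)
Definition I_q : set (laurent_space R F) :=
  [set Theta | forall n : int, 0 <= n -> coefl Theta n = 0].

(* The t-adic absolute value; [mup 0 Q] is the multiplicity of the factor t. *)
Definition abs_t Q : R := #|F|%:R ^- mup 0 Q.

Definition m_t Theta : R :=
  inf [set absl R (polyl Q) * abs_t Q * absl R (fracl (polyl Q * Theta))
      | Q in [set Q : {poly F} | Q != 0]].

Definition E_qt : set (laurent_space R F) :=
  [set Theta | I_q Theta /\ 0 < m_t Theta].

Definition nonresidues : {set F} :=
  [set zeta | zeta != 0 & zeta ^+ (#|F|.-1)./2 == -1]%SET.

Definition Lambda (a : nat -> F -> F) : laurent_space R F :=
  limn (fun n : nat => (\sum_(0 <= k < n) \sum_(zeta in nonresidues)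
    polyl (a k zeta *: 'X^(2 ^ k)) / polyl ('X^(2 ^ k.+1) - zeta%:P)
  : laurent_space R F)).

Definition C_q : set (laurent_space R F) :=
  [set Lambda a
  | a in [set a : nat -> F -> F |
           forall k zeta, zeta \in nonresidues -> a k zeta != 0]].

Definition A_q : R := (#|F|.-1)%:R / 2 * (ln (#|F|.-1)%:R / ln 2).

End Problem.

Arguments I_q : clear implicits.
Arguments E_qt : clear implicits.
Arguments C_q : clear implicits.

(* Main.v *)
Require Import Defs.
From mathcomp Require Import all_boot all_order all_algebra.
From mathcomp Require Import all_classical all_reals all_analysis.
From mathcomp Require Import finfield.
From mathcomp Require Import zify ring lra.

Set Implicit Arguments.
Unset Strict Implicit.
Unset Printing Implicit Defensive.

Import Order.TTheory GRing.Theory Num.Theory.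
Import numFieldNormedType.Exports.

Local Open Scope classical_set_scope.
Local Open Scope ring_scope.

(** Write q = 2d + 1 for the cardinal of the field. Expanding the fractions
    in the series of a collection a, the coefficient of t^-n for
    n = 2^k (2j+1) is the sum of a_(k,z) z^j over the non-residues z; every
    n > 0 has exactly one such form, so this one coefficient sequence c
    carries everything.

    Lower bound for m_t. Multiplying by a power of t only shifts the
    sequence, so the claim on m_t says that no polynomial Q of degree m
    annihilates c (as a linear recurrence) on m + 4d consecutive positions.
    Suppose Q does. On odd positions c is an exponential sum in j with all
    frequencies z and non-zero weights, so an operator N(X) that kills d
    consecutive terms must vanish at every z (Vandermonde). A polynomial
    S = E(X^2) + X O(X^2) is made to act on odd positions alone by
    multiplying it by S(-X), which gives N = E^2 - X O^2; as z is not a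
    square, N(z) = 0 forces E(z) = O(z) = 0, and since X^d + 1 is the product
    of the X - z, the polynomial X^(2d) + 1 divides S
    ([divides_of_zero_run]). The even positions carry a sequence of the same
    kind. After multiplying Q by X^(2d) - 1, the step can be repeated on every
    dyadic level without losing length: Q (X^(2d) - 1) is divisible by
    X^(2d 2^n) - 1 for all n, which is absurd
    ([lambda_seq_no_zero_run]).

    Hausdorff measure. Collections that agree on the levels below n give
    series at distance at most q^-(2^n); collections that differ on some level
    k <= n give series at distance at least q^-(2^n (q-1)). There are
    N = (q-1)^d choices per level, and A_q is the exponent with 2^A_q = N, so
    that h(q^-(2^n m)) is a constant multiple of N^-n. Hence the N^n cylinders
    of level n give a bounded sum. Conversely a set of a cover with diameter
    of order q^-(2^n) lies in a cylinder of level about n, and cylinders that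
    cover all words have total weight sum N^-n at least 1
    ([cylinder_cover_weight]); this bounds every covering sum from below.

    Infinite measure. Adding the monomial t^-(2i+1) to a series changes one
    coefficient, so the zero-run bound survives from there on and the translate
    stays in E_qt. Translates by different monomials are uniformly separated,
    because a difference of two coefficient sequences c that vanishes at d
    consecutive odd positions vanishes at all odd ones. Hence the measure of
    E_qt exceeds any multiple of a fixed positive constant; for A < A_q the
    gauge is even larger near 0. The bound on the dimension follows. *)

(** * Polynomials acting on sequences as shift operators *)

Section Action.
Variable F : fieldType.
Implicit Types (P Q S : {poly F}) (c : nat -> F).

Definition act Q c (n : nat) : F := \sum_(i < size Q) Q`_i * c (n + i)%N.

Lemma act_widen m Q c n : (size Q <= m)%N ->
  act Q c n = \sum_(i < m) Q`_i * c (n + i)%N.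
Proof.
move=> Qm; rewrite /act (big_ord_widen m (fun i => Q`_i * c (n + i)%N))//.
rewrite big_mkcond /=; apply: eq_bigr => i _; case: ltnP => // iQ.
by rewrite nth_default// mul0r.
Qed.

Lemma actD P Q c n : act (P + Q) c n = act P c n + act Q c n.
Proof.
set m := maxn (size P) (size Q).
rewrite !(@act_widen m) ?leq_maxl ?leq_maxr ?size_polyD//.
by rewrite -big_split; apply: eq_bigr => i _; rewrite coefD mulrDl.
Qed.

Lemma actZ a Q c n : act (a *: Q) c n = a * act Q c n.
Proof.
rewrite !(@act_widen (size Q)) ?size_scale_leq// mulr_sumr.
by apply: eq_bigr => i _; rewrite coefZ mulrA.
Qed.

Lemma act0 c n : act 0 c n = 0.
Proof. by rewrite /act size_poly0 big_ord0. Qed.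

Lemma act_sum I (r : seq I) (P : pred I) (Q : I -> {poly F}) c n :
  act (\sum_(i <- r | P i) Q i) c n = \sum_(i <- r | P i) act (Q i) c n.
Proof.
by elim/big_rec2 : _ => [|i x y _ <-]; rewrite ?act0 ?actD.
Qed.

Lemma actXn k c n : act 'X^k c n = c (n + k)%N.
Proof.
rewrite (@act_widen k.+1) ?size_polyXn// (bigD1 ord_max)//= coefXn eqxx mul1r.
rewrite big1 ?addr0// => i; rewrite -val_eqE /= coefXn => /negPf ->.
by rewrite mul0r.
Qed.

Lemma eq_act Q c c' n :
  (forall i, (i < size Q)%N -> c (n + i)%N = c' (n + i)%N) ->
  act Q c n = act Q c' n.
Proof. by move=> cc'; apply: eq_bigr => i _; rewrite cc'. Qed.

Lemma act_eq0 Q c n :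
  (forall i, (i < size Q)%N -> c (n + i)%N = 0) -> act Q c n = 0.
Proof.
by move=> c0; apply: big1 => i _; rewrite c0// mulr0.
Qed.

Lemma act_XnM k Q c n : act ('X^k * Q) c n = act Q c (n + k)%N.
Proof.
rewrite (@act_widen (k + size Q)); last first.
  by apply: leq_trans (size_polyMleq _ _) _; rewrite size_polyXn.
rewrite big_split_ord /= big1 ?add0r; last by move=> i _;
  rewrite coefXnM ltn_ord mul0r.
by apply: eq_bigr => i _; rewrite coefXnM ltnNge leq_addr addKn addnA.
Qed.

Lemma actM P Q c n : act (P * Q) c n = act P (act Q c) n.
Proof.
rewrite -{1}[P]coefK poly_def mulr_suml act_sum; apply: eq_bigr => i _.
by rewrite -scalerAl actZ act_XnM.
Qed.

Lemma act_XnB1 k c n : act ('X^k - 1) c n = c (n + k)%N - c n.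
Proof.
by rewrite -[1]/('X^0) -scaleN1r actD actZ !actXn addn0 mulN1r.
Qed.

Lemma act_comp_Xn m Q c w u :
  act (Q \Po 'X^m) c (w + m * u)%N = act Q (fun v => c (w + m * v)%N) u.
Proof.
rewrite comp_polyE act_sum; apply: eq_bigr => i _.
by rewrite actZ -exprM actXn mulnDr addnA.
Qed.

(** Coefficients of Q whose exponents are r modulo K, so that Q is the sum of
    the 'X^r * (residue_poly K r Q \Po 'X^K) for r < K. *)
Definition residue_poly K r Q : {poly F} := \poly_(i < size Q) Q`_(K * i + r).

Lemma coef_residue_poly K r Q i : (0 < K)%N ->
  (residue_poly K r Q)`_i = Q`_(K * i + r).
Proof.
move=> K0; rewrite coef_poly; case: ltnP => // Qi.
rewrite nth_default//; apply: leq_trans Qi _.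
by apply: leq_trans (leq_addr _ _); rewrite leq_pmull.
Qed.

Lemma poly_residues K Q : (0 < K)%N ->
  Q = \sum_(r < K) 'X^r * (residue_poly K r Q \Po 'X^K).
Proof.
move=> K0; apply/polyP => i; rewrite coef_sum.
rewrite (bigD1 (Ordinal (ltn_pmod i K0)))//= big1 ?addr0.
  rewrite coefXnM ltnNge leq_mod /= coef_comp_poly_Xn//.
  have -> : (i - i %% K = i %/ K * K)%N by rewrite {1}(divn_eq i K) addnK.
  by rewrite dvdn_mull// mulnK// coef_residue_poly// mulnC -divn_eq.
move=> r; rewrite -val_eqE /= => ri; rewrite coefXnM; case: ltnP => // ir.
rewrite coef_comp_poly_Xn//; case: ifP => // /dvdnP[j jE].
by move: ri; rewrite -(subnK ir) jE modnMDl modn_small ?ltn_ord// eqxx.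
Qed.

(** If the sequence lives on the multiples of K, only one residue class of
    exponents contributes at each position. *)
Lemma act_residue K Q c r u n : (0 < K)%N -> (r < K)%N -> (n + r = K * u)%N ->
  (forall j, ~~ (K %| j)%N -> c j = 0) ->
  act Q c n = act (residue_poly K r Q) (fun v => c (K * v)%N) u.
Proof.
move=> K0 rK nr c0; rewrite {1}(poly_residues Q K0) act_sum.
rewrite (bigD1 (Ordinal rK))//= big1 ?addr0.
  by rewrite act_XnM nr -[(K * u)%N]add0n act_comp_Xn.
move=> s; rewrite -val_eqE /= => sr; rewrite act_XnM.
rewrite -[(n + s)%N]addn0 -(muln0 K) act_comp_Xn; apply: act_eq0 => i _.
apply: c0; rewrite dvdn_addl ?dvdn_mulr//; apply: contra sr => Ks.
have : (s == r %[mod K])%N by rewrite -(eqn_modDl n) nr modnMr.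
by rewrite !modn_small.
Qed.

End Action.
(** * Exponential sums over the non-residues *)

Section ExponentialSums.
Variable F : finFieldType.
Implicit Types (Z : {set F}) (w : F -> F) (p : {poly F}).

Lemma act_expsum Z w p n :
  act p (fun j => \sum_(z in Z) w z * z ^+ j) n =
  \sum_(z in Z) w z * p.[z] * z ^+ n.
Proof.
rewrite /act; under eq_bigr do rewrite mulr_sumr.
rewrite exchange_big /=; apply: eq_bigr => z _.
rewrite horner_coef mulr_sumr mulr_suml; apply: eq_bigr => i _.
by rewrite exprD; ring.
Qed.

(** A Vandermonde argument: the hypothesis kills the sum of w z * p.[z] for
    every p of size at most d, in particular for the p that vanishes on all of
    Z but one point. *)
Lemma expsum_eq0 Z w d : (#|Z| <= d)%N ->
  (forall j, (j < d)%N -> \sum_(z in Z) w z * z ^+ j = 0) ->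
  forall z, z \in Z -> w z = 0.
Proof.
move=> Zd w0 z zZ; pose p := \prod_(y <- enum (Z :\ z)%SET) ('X - y%:P).
have sp : size p = #|Z|.
  by rewrite size_prod_XsubC -cardE (cardsD1 z Z) zZ.
have : act p (fun j => \sum_(y in Z) w y * y ^+ j) 0 = 0.
  by apply: act_eq0 => i; rewrite sp add0n => iZ; apply/w0/(leq_trans iZ).
rewrite act_expsum (bigD1 z)//= big1 ?addr0 ?expr0 ?mulr1; last first.
  move=> y /andP[yZ yz]; rewrite [p.[y]](_ : _ = 0) ?mulr0 ?mul0r//.
  by apply/eqP; rewrite -/(root p y) root_prod_XsubC mem_enum !inE yz.
move=> /eqP; rewrite mulf_eq0 => /orP[/eqP//|].
by rewrite -/(root p z) root_prod_XsubC mem_enum !inE eqxx.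
Qed.

End ExponentialSums.

Section Nonresidues.
Variable F : finFieldType.
Hypothesis q_odd : odd #|F|.
Local Notation d := (#|F|.-1)./2.
Local Notation Z := (nonresidues F).

Lemma card_pred_double : #|F|.-1 = d.*2.
Proof. by have := card_finNzRing_gt1 F; move: q_odd; case: #|F| => //= n; lia. Qed.

Lemma half_card_gt0 : (0 < d)%N.
Proof.
by have := card_finNzRing_gt1 F; move: q_odd; case: #|F| => // -[|n] //=; lia.
Qed.

Lemma odd_card_two_neq0 : (2%:R : F) != 0.
Proof.
apply: contraTneq q_odd => F2.
have ch2 : 2 \in [pchar F] by rewrite inE /= F2 eqxx.
have := card_finNzRing_gt1 F; rewrite (card_pprimeChar ch2) oddX negb_or.
by case: logn.
Qed.

Lemma nonresidueE z : (z \in Z) = (z != 0) && (z ^+ d == -1).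
Proof. by rewrite inE. Qed.

Lemma nonresidue_expd z : z \in Z -> z ^+ d = -1.
Proof. by rewrite inE => /andP[_ /eqP]. Qed.

Lemma nonresidue_neq0 z : z \in Z -> z != 0.
Proof. by rewrite inE => /andP[]. Qed.

Lemma unit_exp_card (z : F) : z != 0 -> z ^+ d.*2 = 1.
Proof.
move=> z0; apply: (mulfI z0); rewrite mulr1 -exprS -card_pred_double.
by rewrite (ltn_predK (card_finNzRing_gt1 F)) expf_card.
Qed.

(** By Fermat's little theorem a non-zero square y ^+ 2 satisfies
    (y ^+ 2) ^+ d = 1, which differs from -1 in odd characteristic. *)
Lemma nonresidue_nonsquare z y : z \in Z -> y ^+ 2 != z.
Proof.
move=> zZ; apply: contraTneq (zZ) => <-; rewrite nonresidueE -exprM mul2n.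
rewrite expf_eq0 /=; have [->//|y0] /= := eqVneq y 0.
rewrite unit_exp_card// -subr_eq0 opprK -(natrD _ 1 1).
exact: odd_card_two_neq0.
Qed.

(** Neither 'X^d - 1 nor 'X^d + 1 has more than d roots, and together their
    roots exhaust the 2d units. *)
Lemma card_nonresidues : #|Z| = d.
Proof.
have d0 := half_card_gt0.
have roots_le (c : F) (A : {set F}) :
    (forall z, z \in A -> z ^+ d = c) -> (#|A| <= d)%N.
  move=> AP; have sP : size ('X^d - c%:P) = d.+1 by rewrite size_XnsubC.
  rewrite cardE -ltnS -sP; apply: max_poly_roots; rewrite ?enum_uniq//.
    by rewrite -size_poly_eq0 sP.
  apply/allP => z; rewrite mem_enum => /AP zc.
  by rewrite /root !hornerE zc subrr.
apply/eqP; rewrite eqn_leq (roots_le (-1)) /=; last exact: nonresidue_expd.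
have : (#|[set~ 0%R : F]%SET :\: Z| <= d)%N.
  apply: (roots_le 1) => z; rewrite finset.in_setD nonresidueE finset.in_setC1 andbC.
  case/andP=> z0; rewrite z0 /= => zd.
  have /eqP := unit_exp_card z0; rewrite -muln2 exprM -subr_eq0 subr_sqr_1.
  by rewrite mulf_eq0 subr_eq0 addr_eq0 (negPf zd) orbF => /eqP.
have ZS : Z \subset [set~ 0%R : F]%SET.
  by apply/fintype.subsetP => z /nonresidue_neq0; rewrite finset.in_setC1.
have : #|[set~ 0%R : F]%SET| = d.*2.
  by rewrite -card_pred_double cardsC1.
by rewrite cardsD (finset.setIidPr ZS) => ->; rewrite leq_subLR -addnn leq_add2r.
Qed.

Lemma Xnd1_prod : 'X^d + 1 = \prod_(z <- enum Z) ('X - z%:P) :> {poly F}.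
Proof.
have d0 := half_card_gt0.
have -> : 'X^d + 1 = 'X^d - (-1)%:P :> {poly F} by rewrite polyCN opprK.
rewrite [LHS](@all_roots_prod_XsubC _ _ (enum Z)).
- by rewrite (monicP (monicXnsubC _ d0)) scale1r.
- by rewrite size_XnsubC// -cardE card_nonresidues.
- apply/allP => z; rewrite mem_enum => /nonresidue_expd zd.
  by rewrite /root !hornerE zd subrr.
- by rewrite uniq_rootsE enum_uniq.
Qed.

Lemma Xnd1_dvd (p : {poly F}) : (forall z, z \in Z -> root p z) -> 'X^d + 1 %| p.
Proof.
move=> pZ; rewrite Xnd1_prod uniq_roots_dvdp ?uniq_rootsE ?enum_uniq//.
by apply/allP => z; rewrite mem_enum; exact: pZ.
Qed.

Lemma comp_XnD1 m n : ('X^m + 1 : {poly F}) \Po 'X^n = 'X^(n * m) + 1.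
Proof. by rewrite comp_polyD comp_Xn_poly comp_polyC -exprM. Qed.

Lemma comp_XnB1 m n : ('X^m - 1 : {poly F}) \Po 'X^n = 'X^(n * m) - 1.
Proof. by rewrite comp_polyB comp_Xn_poly comp_polyC -exprM. Qed.

(** The core step. The run of M zeros of S * ('X^(2d) - 1) loses size S - 1
    positions to the multiplication by S \Po - 'X, which makes the operator a
    polynomial in 'X^2; what remains contains d consecutive odd positions. There
    the values are an exponential sum with weights a z * G.[z], so G, and with
    it E^2 - X O^2, vanishes at every non-residue. *)
Lemma divides_of_zero_run (a : F -> F) (c : nat -> F) (S : {poly F}) M w :
  (forall z, z \in Z -> a z != 0) ->
  (forall j, c j.*2.+1 = \sum_(z in Z) a z * z ^+ j) ->
  (size S + #|F|.-1 <= M.+1)%N ->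
  (forall i, (i < M)%N -> act (S * ('X^(#|F|.-1) - 1)) c (w + i) = 0) ->
  'X^(#|F|.-1) + 1 %| S.
Proof.
move=> a0 cE SM S0; have qd := card_pred_double; set q' := #|F|.-1 in qd SM S0 *.
pose E := even_poly S; pose O := odd_poly S.
pose G := (E ^+ 2 - 'X * O ^+ 2) * ('X^d - 1).
have SE : S = (E \Po 'X^2) + (O \Po 'X^2) * 'X by rewrite poly_even_odd.
pose T := S \Po (- 'X).
have sT : (size T <= size S)%N by rewrite size_comp_poly2// size_polyN size_polyX.
(* G \Po 'X^2 only connects positions of the same parity. *)
have GE : G \Po 'X^2 = T * (S * ('X^q' - 1)).
  rewrite /T {2}SE {1}SE qd -mul2n -comp_XnB1 /G comp_polyM [RHS]mulrA.
  congr (_ * _). rewrite comp_polyB comp_polyD !expr2 !comp_polyM -!comp_polyA.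
  rewrite !comp_polyM !comp_polyX mulrNN.
  by ring.
have Gw i : (i < q')%N -> act (G \Po 'X^2) c (w + i) = 0.
  move=> iq; rewrite GE actM; apply: act_eq0 => l lT; rewrite -addnA S0//.
  by move: (leq_trans lT sT); lia.
(* The first odd position that is at least w is 1 + 2 * w./2. *)
have Gz z : z \in Z -> a z * G.[z] * z ^+ w./2 = 0.
  apply: (@expsum_eq0 _ Z (fun z => a z * G.[z] * z ^+ w./2) d).
    by rewrite card_nonresidues.
  move=> j jd; under eq_bigr do rewrite -mulrA -exprD.
  rewrite -act_expsum.
  have -> : (fun j => \sum_(z in Z) a z * z ^+ j) = (fun v => c (1 + 2 * v)%N).
    by apply/funext => v; rewrite -cE mul2n.
  rewrite -act_comp_Xn.
  have -> : (1 + 2 * (w./2 + j) = w + (1 + 2 * (w./2 + j) - w))%N by lia.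
  by apply: Gw; lia.
have EO z : z \in Z -> root E z /\ root O z.
  move=> zZ; have := Gz z zZ => /eqP; rewrite !mulf_eq0 (negPf (a0 z zZ)) /=.
  rewrite expf_eq0 (negPf (nonresidue_neq0 zZ)) andbF orbF hornerM mulf_eq0.
  rewrite [X in _ || X](_ : _ = false) ?orbF; last first.
    rewrite !hornerE (nonresidue_expd zZ) -opprD oppr_eq0 -(natrD _ 1 1).
    exact/negbTE/odd_card_two_neq0.
  rewrite !hornerE subr_eq0 => /eqP EO2.
  have EOz : E.[z] ^+ 2 = z * O.[z] ^+ 2 by rewrite EO2 expr2 mulrA.
  have [Oz|Onz] := eqVneq O.[z] 0.
    split; last by apply/eqP.
    by move/eqP: EOz; rewrite Oz expr0n /= mulr0 sqrf_eq0.
  have := nonresidue_nonsquare (E.[z] / O.[z]) zZ.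
  by rewrite expr_div_n EOz mulfK ?eqxx// expf_neq0.
rewrite qd -mul2n -comp_XnD1 SE; apply: dvdp_add; last apply: dvdp_mulr.
  by apply/dvdp_comp_poly/Xnd1_dvd => z /EO[].
by apply/dvdp_comp_poly/Xnd1_dvd => z /EO[].
Qed.

End Nonresidues.
(** * The coefficient sequence has no long linear recurrence *)

Section LambdaSequence.
Variable F : finFieldType.
Implicit Types (a : nat -> F -> F).
Local Notation d := (#|F|.-1)./2.
Local Notation Z := (nonresidues F).

(** The coefficient of t^-n in the series attached to a: for
    n = 2^k (2j+1) the exponent below is j. *)
Definition lambda_seq a (n : nat) : F :=
  if n == 0%N then 0 else
  \sum_(z in Z) a (logn 2 n) z * z ^+ (n %/ 2 ^ logn 2 n)./2.

Lemma logn2_dyadic k j : logn 2 (2 ^ k * j.*2.+1) = k.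
Proof.
rewrite lognM ?expn_gt0// pfactorK// logn_coprime ?addn0//.
by rewrite coprime2n /= odd_double.
Qed.

Lemma dyadicP n : (0 < n)%N -> exists k j, n = (2 ^ k * j.*2.+1)%N.
Proof.
move=> n0; have [m] := pfactor_coprime (isT : prime 2) n0.
rewrite coprime2n => om ->; exists (logn 2 n), m./2.
by rewrite mulnC -[in RHS](odd_double_half m) om; congr (_ * _)%N; lia.
Qed.

Lemma lambda_seqE a k j :
  lambda_seq a (2 ^ k * j.*2.+1) = \sum_(z in Z) a k z * z ^+ j.
Proof.
rewrite /lambda_seq muln_eq0 expn_eq0 /= logn2_dyadic.
by rewrite mulKn ?expn_gt0//= uphalf_double.
Qed.

Lemma lambda_seq0 a : lambda_seq a 0 = 0.
Proof. by []. Qed.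

(** Self-similarity: the multiples of 2^n carry a sequence of the same kind. *)
Lemma lambda_seq_shift a n u :
  lambda_seq a (2 ^ n * u) = lambda_seq (fun k => a (n + k)%N) u.
Proof.
have [->|/dyadicP[k [j ->]]] := posnP u; first by rewrite muln0 !lambda_seq0.
by rewrite mulnA -expnD !lambda_seqE.
Qed.

Hypothesis q_odd : odd #|F|.

(** On level k < n the shift by 2^n * 2d adds d * 2^(n-k) to j, and
    z^(d * 2^(n-k)) = (-1)^(2^(n-k)) = 1. *)
Lemma lambda_seq_periodic a n i : ~~ (2 ^ n %| i)%N ->
  lambda_seq a (i + 2 ^ n * #|F|.-1) = lambda_seq a i.
Proof.
have [->|/dyadicP[k [j ->]]] := posnP i; first by rewrite dvdn0.
have [nk|kn _] := leqP n k; first by rewrite dvdn_mulr// dvdn_exp2l.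
rewrite card_pred_double//.
have -> : (2 ^ k * j.*2.+1 + 2 ^ n * d.*2 =
           2 ^ k * (j + 2 ^ (n - k) * d).*2.+1)%N.
  by rewrite doubleD -addSn mulnDr doubleMr mulnA -expnD subnKC// ltnW.
rewrite !lambda_seqE; apply: eq_bigr => z zZ; congr (_ * _).
rewrite exprD mulnC exprM (nonresidue_expd zZ).
have -> : (n - k = (n - k).-1.+1)%N by lia.
by rewrite expnS exprM sqrrN expr1n expr1n mulr1.
Qed.

(** If there were such a run of zeros, Q * ('X^(2d) - 1) would be divisible by
    'X^(2^n * 2d) - 1 for every n. In the induction on n the cofactor S acts on
    the sequence e, which is supported on the multiples of K = 2^n and equals
    there the sequence of level n acted on by 'X^(2d) - 1; so the core step
    applies to each residue class of exponents of S modulo K. *)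
Lemma lambda_seq_no_zero_run a (Q : {poly F}) w :
  (forall k z, z \in Z -> a k z != 0) -> Q != 0 ->
  exists2 i, (i < (size Q).-1 + 2 * #|F|.-1)%N &
    act Q (lambda_seq a) (w + i) != 0.
Proof.
move=> a0 Q0; apply/not_exists2P => /= Qz.
have {}Qz i : (i < (size Q).-1 + 2 * #|F|.-1)%N ->
    act Q (lambda_seq a) (w + i) = 0.
  by have [//|/negP/negPn/eqP//] := Qz i.
have q0 : (0 < #|F|.-1)%N.
  by rewrite card_pred_double// double_gt0 half_card_gt0.
have nzX m : (0 < m)%N -> ('X^m - 1 : {poly F}) != 0.
  by move=> m0; rewrite -size_poly_eq0 size_XnsubC.
set q' := #|F|.-1 in Qz q0.
suff div n : exists S : {poly F}, Q * ('X^q' - 1) = S * ('X^(2 ^ n * q') - 1).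
  pose n := size (Q * ('X^q' - 1)); have [S SE] := div n.
  have : Q * ('X^q' - 1) != 0 by rewrite mulf_neq0// nzX.
  rewrite SE mulf_eq0 negb_or => /andP[S0 X0].
  have := size_mul S0 X0; rewrite -SE -/n size_XnsubC; last first.
    by rewrite muln_gt0 expn_gt0.
  have : (0 < size S)%N by rewrite size_poly_gt0.
  have : (n < 2 ^ n)%N by exact: ltn_expl.
  have : (2 ^ n <= 2 ^ n * q')%N by rewrite leq_pmulr.
  by lia.
elim: n => [|n [S SE]]; first by exists Q; rewrite expn0 mul1n.
have K0 : (0 < 2 ^ n)%N by rewrite expn_gt0.
set K := (2 ^ n)%N in SE K0.
have S0 : S != 0.
  have : Q * ('X^q' - 1) != 0 by rewrite mulf_neq0// nzX.
  by rewrite SE mulf_eq0 negb_or => /andP[].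
have szS : (size S + K * q' = (size Q).-1 + q' + 1)%N.
  have := size_mul S0 (nzX _ (_ : 0 < K * q')%N); rewrite -SE muln_gt0 K0 q0.
  have := size_mul Q0 (nzX _ q0); rewrite !size_XnsubC ?muln_gt0 ?K0//.
  have : (0 < size Q)%N by rewrite size_poly_gt0.
  by move: (K * q')%N => x + -> /(_ isT); move: (size Q) (size S) (q') => m k l;
  clear; lia.
suff : 'X^(K * q') + 1 %| S.
  move=> /dvdpP[S' S'E]; exists S'; rewrite SE S'E expnS -/K.
  by rewrite -mulnA [(2 * _)%N]mulnC [in RHS]exprM subr_sqr_1
    -mulrA [X in _ * X]mulrC.
rewrite (poly_residues S K0).
apply: (big_ind (fun T => 'X^(K * q') + 1 %| T));
  [exact: dvdp0 | exact: dvdp_add |].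
move=> r _; apply: dvdp_mull.
rewrite -comp_XnD1; apply: dvdp_comp_poly.
(* Of the deg Q + 4d zeros, 2d are spent on the factor 'X^q' - 1. *)
pose m := ((size Q).-1 + q')%N.
pose e := act ('X^(K * q') - 1) (lambda_seq a).
have eK j : ~~ (K %| j)%N -> e j = 0.
  by move=> Kj; rewrite /e act_XnB1 lambda_seq_periodic// subrr.
have Se i : (i < m)%N -> act S e (w + i) = 0.
  move=> im; rewrite /e -actM -SE mulrC actM act_XnB1 -addnA !Qz ?subrr//.
    by rewrite /m in im; lia.
  by rewrite /m in im; lia.
(* Any m consecutive positions contain at least m %/ K that are -r modulo K; the first
   one is located by a division rounded upwards. *)
have Km : (m < (m %/ K).+1 * K)%N by rewrite ltn_ceil.
apply: (@divides_of_zero_run _ q_odd (a n) (lambda_seq (fun k => a (n + k)%N))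
  _ (m %/ K) ((w + r + K).-1 %/ K)) => //.
- by move=> z; exact: a0.
- move=> j; rewrite -[j.*2.+1]mul1n -[1%N]/(2 ^ 0)%N lambda_seqE.
  by rewrite addn0.
- rewrite -/q'.
  have q'M : (q' <= m %/ K)%N.
    have : (0 < size S)%N by rewrite size_poly_gt0.
    rewrite leq_divRL// mulnC; move: szS; rewrite -/m.
    by move: (K * q')%N (size S) (m); clear; lia.
  suff : (size (residue_poly K r S) <= (m %/ K).+1 - q')%N.
    by rewrite addnC -leq_subRL// (leq_trans q'M).
  apply/leq_sizeP => j jM; rewrite coef_residue_poly// nth_default//.
  have : (K * ((m %/ K).+1 - q') <= K * j)%N by rewrite leq_mul2l jM orbT.
  rewrite mulnBr [(K * _.+1)%N]mulnC; move: Km szS; rewrite -/m.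
  move: ((m %/ K).+1 * K)%N (K * q')%N (K * j)%N (size S) (m) (r : nat).
  by clear; lia.
move=> i iM; rewrite -/q' actM.
set u := (_ + i)%N.
have ceil1 : (w + r <= (w + r + K).-1 %/ K * K)%N.
  have := ltn_ceil (w + r + K).-1 K0; rewrite mulSn; lia.
have ceil2 : ((w + r + K).-1 %/ K * K <= (w + r + K).-1)%N by exact: leq_divM.
have MK : (m %/ K * K <= m)%N by exact: leq_divM.
have iK : (i.+1 * K <= m %/ K * K)%N by rewrite leq_mul2r iM orbT.
have uK : (K * u = (w + r + K).-1 %/ K * K + i * K)%N by rewrite /u; ring.
have -> : act ('X^q' - 1) (lambda_seq (fun k => a (n + k)%N)) =
          fun v => e (K * v)%N.
  apply/funext => v; rewrite /e !act_XnB1 -mulnDr.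
  by rewrite !lambda_seq_shift.
have [j [jm ju]] : exists j, (j < m)%N /\ (w + j + r = K * u)%N.
  by exists (K * u - w - r)%N; rewrite mulSn in iK; split; lia.
by rewrite -(@act_residue _ _ _ _ _ _ (w + j)%N)// Se.
Qed.

End LambdaSequence.
(** * Laurent series and the quantity m_t *)

Section LaurentCoefficients.
Variables (R : realType) (F : finFieldType).
Implicit Types (Theta : laurent_space R F) (Q : {poly F}).
Local Notation q := (#|F|%:R : R).

Lemma card_gt1 : 1 < q.
Proof. by rewrite ltr1n; exact: card_finNzRing_gt1. Qed.

Lemma card_gt0 : 0 < q.
Proof. exact: lt_trans card_gt1. Qed.

Lemma absl_ge (f : laurent F) n : coefl f n != 0 -> q ^ n <= absl R f.
Proof.
move=> fn; have f0 : f != 0 by apply: contraNneq fn => ->.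
rewrite /absl (negPf f0) ler_eXz2l ?card_gt1//.
by rewrite leNgt; apply: contra fn => /(deglP f0).2 ->.
Qed.

Lemma degl_polyl Q : Q != 0 -> degl (polyl Q) = (size Q).-1%:Z.
Proof.
move=> Q0; have sQ : (0 < size Q)%N by rewrite size_poly_gt0.
have P0 : polyl Q != 0.
  apply: contraNneq Q0 => /(congr1 (fun f => coefl f (size Q).-1%:Z)) /= Qs.
  by rewrite -lead_coef_eq0 lead_coefE Qs.
have [Pd Pl] := deglP P0; apply/eqP; rewrite eq_le; apply/andP; split.
  rewrite leNgt; apply/negP => Qd; move: Pd; case: (degl _) Qd => [m|//] Qd.
  by rewrite /= nth_default ?eqxx//; move: Qd; rewrite ltz_nat prednK.
rewrite leNgt; apply/negP => /Pl /= /eqP.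
by rewrite -lead_coefE lead_coef_eq0 (negPf Q0).
Qed.

Lemma absl_polyl Q : Q != 0 -> absl R (polyl Q) = q ^+ (size Q).-1.
Proof.
move=> Q0; rewrite /absl degl_polyl//; case: eqP => // P0.
have := degl_polyl Q0; rewrite P0 => D.
have : coefl (polyl Q) (size Q).-1%:Z = 0 by rewrite P0.
by move=> /= /eqP; rewrite -lead_coefE lead_coef_eq0 (negPf Q0).
Qed.

Lemma coefl_polylM Q (f : laurent F) n :
  coefl (polyl Q * f) n = \sum_(i < size Q) Q`_i * coefl f (n - i%:Z).
Proof.
rewrite coeflM (fsbigE [seq i%:Z | i <- iota 0 (size Q)])//.
- under eq_bigl do rewrite in_setT.
  rewrite big_map -(big_mkord xpredT (fun i => Q`_i * coefl f (n - i%:Z))).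
  by rewrite /index_iota subn0.
- by rewrite map_inj_uniq ?iota_uniq// => i j [].
- move=> [i|i] _; last by rewrite /= mul0r.
  rewrite mem_map; last by move=> ? ? [].
  rewrite mem_iota add0n /= -leqNgt => Qi.
  by rewrite nth_default ?mul0r.
Qed.

Definition tail_coef (f : laurent F) (n : nat) : F := coefl f (- n%:Z).

Lemma tail_coef_polylM Q f n :
  tail_coef (polyl Q * f) n = act Q (tail_coef f) n.
Proof.
rewrite /tail_coef coefl_polylM; apply: eq_bigr => i _.
by rewrite PoszD opprD.
Qed.

(** Writing Q = t^v Q', the factor |Q|_t cancels q^v, while multiplication by
    t^v only moves the window in which a non-zero coefficient is sought. *)
Lemma m_t_ge Theta L :
  (forall Q w, Q != 0 -> exists2 i, (i < (size Q).-1 + L)%N &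
    act Q (tail_coef Theta) (w.+1 + i) != 0) ->
  q ^- L <= m_t Theta.
Proof.
move=> run; apply: lb_le_inf.
  by eexists; exists 1; [rewrite /= oner_neq0|reflexivity].
move=> _ [Q /= Q0 <-].
have qX n : 0 < q ^+ n by rewrite exprn_gt0// card_gt0.
set v := mup 0 Q.
have : ('X - 0%:P) ^+ v %| Q by rewrite -mup_geq.
rewrite subr0 => /dvdpP[Q' QE].
have Q'0 : Q' != 0 by apply: contraNneq Q0 => Q'0; rewrite QE Q'0 mul0r.
have sQ : ((size Q).-1 = v + (size Q').-1)%N.
  rewrite QE size_Mmonic ?monicXn// size_polyXn addnS /= addnC -!subn1.
  by rewrite addnBA// size_poly_gt0.
have [i iL ai] := run Q' v Q'0.
have fi : q ^ (- i.+1%:Z) <= absl R (fracl (polyl Q * Theta)).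
  apply: absl_ge; rewrite -[coefl _ _]/(tail_coef (polyl Q * Theta) i.+1).
  rewrite tail_coef_polylM QE mulrC act_XnM.
  by have -> : (i.+1 + v = v.+1 + i)%N by lia.
rewrite absl_polyl// sQ /abs_t -/v exprD [q ^+ v * _]mulrC mulfK ?gt_eqF//.
apply: le_trans (ler_wpM2l _ fi); last exact: ltW.
rewrite -exprnN ler_pdivlMr// mulrC ler_pdivrMr// -exprD ler_eXn2l ?card_gt1//.
Qed.


Lemma tail_coef_act_eq Theta (c : nat -> F) b Q n :
  (forall i, (b < i)%N -> tail_coef Theta i = c i) -> (b < n)%N ->
  act Q (tail_coef Theta) n = act Q c n.
Proof.
by move=> Tc bn; apply: eq_act => i _; apply: Tc; apply: ltn_addr.
Qed.

(** A change of the first b coefficients costs at most a factor q^b. *)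
Lemma m_t_lambda_ge (q_odd : odd #|F|) (a : nat -> F -> F) b Theta :
  (forall k z, z \in nonresidues F -> a k z != 0) ->
  (forall i, (b < i)%N -> tail_coef Theta i = lambda_seq a i) ->
  q ^- (2 * #|F|.-1 + b) <= m_t Theta.
Proof.
move=> a0 Ta; apply: m_t_ge => Q w Q0.
have [i im ai] := lambda_seq_no_zero_run q_odd (w + b).+1 a0 Q0.
exists (b + i)%N; first by rewrite addnA [(b + i)%N]addnC ltn_add2r.
rewrite (tail_coef_act_eq _ Ta); first by rewrite addnA addSn.
by rewrite addSn ltnS addnCA leq_addr.
Qed.

Definition lambda_coefl (a : nat -> F -> F) (n : int) : F :=
  if n is Negz k then lambda_seq a k.+1 else 0.

Fact lambda_series_subproof a : `[< exists N : int, forall n, N < n ->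
  lambda_coefl a n = 0 >].
Proof. by apply/asboolP; exists 0 => -[k|k]. Qed.

Definition lambda_series a : laurent_space R F :=
  Laurent (lambda_series_subproof a).

Lemma lambda_series_I_q a : I_q R F (lambda_series a).
Proof. by move=> [n|n]. Qed.

Lemma tail_coef_lambda_series a n : tail_coef (lambda_series a) n = lambda_seq a n.
Proof. by case: n. Qed.

Lemma lambda_seq_sum I (r : seq I) (P : pred I) (a : I -> nat -> F -> F) n :
  lambda_seq (fun k z => \sum_(i <- r | P i) a i k z) n =
  \sum_(i <- r | P i) lambda_seq (a i) n.
Proof.
have [->|/dyadicP[k [j ->]]] := posnP n; first by rewrite lambda_seq0 big1.
rewrite lambda_seqE; under [RHS]eq_bigr do rewrite lambda_seqE.
by rewrite exchange_big; apply: eq_bigr => z _; rewrite mulr_suml.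
Qed.

Lemma coefl_sum I (r : seq I) (P : pred I) (f : I -> laurent F) n :
  coefl (\sum_(i <- r | P i) f i) n = \sum_(i <- r | P i) coefl (f i) n.
Proof. by elim/big_rec2: _ => // i x y _ <-. Qed.

Lemma lambda_series_sum I (r : seq I) (P : pred I) (a : I -> nat -> F -> F) :
  \sum_(i <- r | P i) lambda_series (a i) =
  lambda_series (fun k z => \sum_(i <- r | P i) a i k z).
Proof.
apply: laurentP => n; rewrite coefl_sum.
by case: n => n /=; [rewrite big1 | rewrite lambda_seq_sum].
Qed.

(** The collection with the only non-zero entry c at (k, z): its series is one
    summand of the series defining Lambda. *)
Definition single_coef (k : nat) (z c : F) (k' : nat) (z' : F) : F :=
  if (k' == k) && (z' == z) then c else 0.

Lemma lambda_seq_single k z c k' j : z \in nonresidues F ->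
  lambda_seq (single_coef k z c) (2 ^ k' * j.*2.+1) =
  if k' == k then c * z ^+ j else 0.
Proof.
move=> zZ; rewrite lambda_seqE (bigD1 z)//= /single_coef eqxx andbT.
rewrite big1 ?addr0; first by case: eqP; rewrite ?mul0r.
by move=> y /andP[_ /negPf ->]; rewrite andbF mul0r.
Qed.


Lemma coefl_polylXnM m (f : laurent F) n :
  coefl (polyl 'X^m * f) n = coefl f (n - m%:Z).
Proof.
rewrite coefl_polylM size_polyXn (bigD1 ord_max)//= big1 ?addr0; last first.
  by move=> i; rewrite -val_eqE /= coefXn => /negPf ->; rewrite mul0r.
by rewrite coefXn eqxx mul1r.
Qed.

Lemma coefl_polylCM z (f : laurent F) n :
  coefl (polyl z%:P * f) n = z * coefl f n.
Proof.
rewrite coefl_polylM size_polyC; have [->|z0] := eqVneq z 0.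
  by rewrite big_ord0 mul0r.
by rewrite big_ord1 coefC eqxx subr0.
Qed.

(** Checked after multiplication by the denominator: the coefficients at n and
    n - 2^k.+1 cancel unless n = 2^k. *)
Lemma lambda_block k z c : z \in nonresidues F ->
  polyl (c *: 'X^(2 ^ k)) / polyl ('X^(2 ^ k.+1) - z%:P) =
  lambda_series (single_coef k z c) :> laurent F.
Proof.
move=> zZ; set h := lambda_series _.
have D0 : polyl ('X^(2 ^ k.+1) - z%:P) != 0 :> laurent F.
  apply/eqP => /(congr1 (fun f => coefl f (2 ^ k.+1)%N%:Z)) /= /eqP.
  by rewrite coefB coefXn eqxx coefC expn_eq0 subr0 oner_eq0.
apply: (mulIf D0); rewrite divfK// [RHS]mulrC raddfB mulrBl.
apply: laurentP => n; rewrite coeflB coefl_polylXnM coefl_polylCM.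
have hpos (i : nat) : coefl h i%:Z = 0 by [].
have hneg (i : nat) : coefl h (- i%:Z) = lambda_seq (single_coef k z c) i.
  exact: tail_coef_lambda_series.
have [mn|nm] := leP (2 ^ k.+1)%N%:Z n.
  have -> : n - (2 ^ k.+1)%N%:Z = `|n - (2 ^ k.+1)%N%:Z|%N%:Z by lia.
  have nE : n = `|n|%N%:Z by lia.
  rewrite hpos nE hpos /= mulr0 subr0 coefZ coefXn.
  have -> : (`|n|%N == 2 ^ k)%N = false; last by rewrite mulr0.
  apply/eqP => nk; move: mn; rewrite nE expnS nk lez_nat -{2}[(2 ^ k)%N]mul1n.
  by rewrite leq_pmul2r ?expn_gt0.
have [s s0 nE] : exists2 s, (0 < s)%N & n = (2 ^ k.+1)%N%:Z - s%:Z.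
  by exists `|(2 ^ k.+1)%N%:Z - n|%N; lia.
have -> : n - (2 ^ k.+1)%N%:Z = - s%:Z by rewrite nE; lia.
rewrite hneg; have [k' [j sE]] := dyadicP s0.
rewrite sE lambda_seq_single//; have [kk|nkk] := eqVneq k' k.
  case: j => [|j] in sE *.
    have nk : n = (2 ^ k)%N%:Z by rewrite nE sE kk muln1 expnS; lia.
    by rewrite nk hpos /= coefZ coefXn eqxx mulr0 subr0.
  have nk : n = - (2 ^ k * j.*2.+1)%N%:Z.
    by rewrite nE sE kk doubleS !mulnS expnS; lia.
  rewrite nk hneg lambda_seq_single// eqxx.
  have -> : coefl (polyl (c *: 'X^(2 ^ k))) (- (2 ^ k * j.*2.+1)%N%:Z) = 0.
    by rewrite mulnS; case: (2 ^ k)%N (expn_gt0 2 k).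
  by rewrite exprS; ring.
have [n0|n0] := leP 0 n.
  have nE' : n = `|n|%N%:Z by lia.
  rewrite nE' hpos /= coefZ coefXn mulr0 subr0.
  case: eqP; rewrite ?mulr0// => nk; case/eqP: nkk.
  have : s = (2 ^ k * 0.*2.+1)%N by move: nE; rewrite nE' nk muln1 expnS; lia.
  by move=> sk; rewrite -(logn2_dyadic k' j) -sE sk logn2_dyadic.
have [i i0 ni] : exists2 i, (0 < i)%N & n = - i%:Z.
  by exists `|n|%N; lia.
rewrite ni hneg; have [l [j' iE]] := dyadicP i0.
rewrite iE lambda_seq_single//.
have -> : (l == k) = false.
  apply/eqP => lk; case/eqP: nkk.
  have : s = (2 ^ k * j'.+1.*2.+1)%N.
    by move: nE; rewrite ni iE lk doubleS !mulnS expnS; lia.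
  by move=> sk; rewrite -(logn2_dyadic k' j) -sE sk logn2_dyadic.
rewrite mulr0 subr0 -iE; case: i i0 {iE ni} => //.
Qed.

Lemma expr_lt_near (x e : R) : 0 <= x < 1 -> 0 < e ->
  \forall n \near \oo, x ^+ n < e.
Proof.
move=> /andP[x0 x1] e0.
have x1' : `|x| < 1 by rewrite ger0_norm.
have /cvgrPdist_lt/(_ _ e0) := cvg_expr x1'; apply: filterS => n.
by rewrite sub0r normrN ger0_norm// exprn_ge0.
Qed.

Lemma absl_le_expV (f : laurent F) (n : nat) :
  (forall i : int, - n%:Z < i -> coefl f i = 0) -> absl R f <= q ^- n.
Proof. by move=> fn; rewrite exprnN; apply/absl_le. Qed.

Lemma eq_lambda_seq (a b : nat -> F -> F) n i :
  (forall k z, z \in nonresidues F -> (k < n)%N -> a k z = b k z) ->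
  (i < 2 ^ n)%N -> lambda_seq a i = lambda_seq b i.
Proof.
move=> ab; have [->//|/dyadicP[k [j ->]]] := posnP i => kn.
rewrite !lambda_seqE; apply: eq_bigr => z zZ; rewrite ab//.
rewrite -(ltn_exp2l _ _ (isT : 1 < 2)%N); apply: leq_ltn_trans kn.
by rewrite leq_pmulr.
Qed.

Lemma absl_lambda_series_le (a b : nat -> F -> F) n :
  (forall k z, z \in nonresidues F -> (k < n)%N -> a k z = b k z) ->
  absl R (lambda_series a - lambda_series b) <= q ^- (2 ^ n).
Proof.
move=> ab; apply: absl_le_expV => -[i|i] ni; rewrite coeflB /= ?subr0//.
apply/eqP; rewrite subr_eq0; apply/eqP; apply: eq_lambda_seq ab _.
by move: ni; rewrite NegzE ltrN2 ltz_nat.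
Qed.

Lemma Lambda_series a : Lambda R a = lambda_series a.
Proof.
rewrite /Lambda; apply: cvg_lim; first exact: metric_hausdorff.
apply/metricType_numDomainType.cvgrPdist_lt => e e0.
have qV : 0 <= q^-1 < 1.
  by rewrite invr_ge0 ltW ?card_gt0//= invf_lt1 ?card_gt0// card_gt1.
have := expr_lt_near qV e0; apply: filterS => n; apply: le_lt_trans.
have -> : \sum_(0 <= k < n) \sum_(z in nonresidues F)
    polyl (a k z *: 'X^(2 ^ k)) / polyl ('X^(2 ^ k.+1) - z%:P) =
    lambda_series (fun k' z' => \sum_(0 <= k < n) \sum_(z in nonresidues F)
      single_coef k z (a k z) k' z') :> laurent F.
  rewrite -lambda_series_sum; apply: eq_bigr => k _.
  rewrite -lambda_series_sum; apply: eq_bigr => z zZ.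
  exact: lambda_block.
apply: (@le_trans _ _ (q ^- (2 ^ n))).
  apply: absl_lambda_series_le => k z zZ kn.
  rewrite (bigD1_seq k) ?iota_uniq ?mem_index_iota//= [X in _ + X]big1 ?addr0.
    rewrite (bigD1 z)//= big1 ?addr0 /single_coef ?eqxx//.
    by move=> y /andP[_ /negPf yz]; rewrite eq_sym yz andbF.
  by move=> l /negPf lk; apply: big1 => y _; rewrite /single_coef eq_sym lk.
rewrite exprVn lef_pV2 ?posrE ?exprn_gt0 ?card_gt0//.
by rewrite ler_eXn2l ?card_gt1// ltnW// ltn_expl.
Qed.

End LaurentCoefficients.

(** * Distances between series and their translates *)

Section Separation.
Variables (R : realType) (F : finFieldType).
Hypothesis q_odd : odd #|F|.
Implicit Types (a b : nat -> F -> F).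
Local Notation q := (#|F|%:R : R).
Local Notation d := (#|F|.-1)./2.
Local Notation Z := (nonresidues F).

(** On level n the difference of the sequences is an exponential sum, which
    cannot vanish for d consecutive values of j. *)
Lemma lambda_seq_neq a b n z J : z \in Z -> a n z != b n z ->
  exists2 j, (J <= j < J + d)%N &
    lambda_seq a (2 ^ n * j.*2.+1) != lambda_seq b (2 ^ n * j.*2.+1).
Proof.
move=> zZ ab; apply/not_exists2P => /= eq_ab; move: ab; apply/negP/negPn.
have : (a n z - b n z) * z ^+ J = 0.
  apply: (@expsum_eq0 _ Z (fun z => (a n z - b n z) * z ^+ J) d) => //.
    by rewrite card_nonresidues.
  move=> j jd; under eq_bigr do rewrite -mulrA -exprD mulrBl.
  rewrite sumrB -!lambda_seqE; apply/eqP; rewrite subr_eq0.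
  have [|/negP/negPn//] := eq_ab (J + j)%N.
  by rewrite leq_addr ltn_add2l jd.
move/eqP; rewrite mulf_eq0 expf_eq0 (negPf (nonresidue_neq0 zZ)) andbF orbF.
by rewrite subr_eq0.
Qed.

Lemma absl_geV (f : laurent F) i m : (i <= m)%N -> tail_coef f i != 0 ->
  q ^- m <= absl R f.
Proof.
move=> im /(absl_ge R); apply: le_trans; rewrite -exprnN.
by rewrite lef_pV2 ?posrE ?exprn_gt0 ?card_gt0// ler_eXn2l ?card_gt1.
Qed.

Lemma absl_lambda_series_ge a b n z : z \in Z -> a n z != b n z ->
  q ^- (2 ^ n * #|F|.-1) <= absl R (lambda_series R a - lambda_series R b).
Proof.
move=> zZ ab; have [j /andP[_ jd] abj] := lambda_seq_neq 0 zZ ab.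
apply: absl_geV (_ : _ <= _)%N _; last first.
  rewrite /tail_coef coeflB -/(tail_coef _ _) -/(tail_coef _ _) subr_eq0.
  by rewrite !tail_coef_lambda_series; exact: abj.
by rewrite leq_mul2l card_pred_double// ltn_double jd orbT.
Qed.

Fact spike_subproof m : `[< exists N : int, forall n, N < n ->
  (n == Negz m.*2)%:R = 0 :> F >].
Proof.
apply/asboolP; exists 0 => n n0; case: eqP => // nm.
by move: n0; rewrite nm.
Qed.

(** The monomial t^-(2m+1). *)
Definition spike m : laurent_space R F := Laurent (spike_subproof m).

Lemma tail_coef_spike m n : tail_coef (spike m) n = (n == m.*2.+1)%:R.
Proof.
by rewrite /tail_coef /= NegzE eqr_opp.
Qed.

(** Either the sequences of a and b differ on odd positions, hence at one that
    lies beyond both spikes, or they agree there and the two spikes are seen. *)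
Lemma absl_translate_ge a b i j J : i != j -> (i < J)%N -> (j < J)%N ->
  q ^- (J.*2 + #|F|.-1) <=
  absl R ((lambda_series R a + spike i) - (lambda_series R b + spike j)).
Proof.
move=> ij iJ jJ; set f := _ - _.
have fE n : tail_coef f n = (lambda_seq a n + (n == i.*2.+1)%:R) -
                            (lambda_seq b n + (n == j.*2.+1)%:R).
  rewrite -!(tail_coef_lambda_series R) -!tail_coef_spike.
  by rewrite /f {1}/tail_coef coeflB !coeflD.
have [ab|/existsPn ab] := boolP [exists z, (z \in Z) && (a 0 z != b 0 z)].
  have /existsP[z /andP[zZ abz]] := ab.
  have [u /andP[Ju ud]] := lambda_seq_neq J zZ abz; rewrite expn0 mul1n => abu.
  apply: (@absl_geV _ u.*2.+1).
    by rewrite card_pred_double// -doubleD ltn_double.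
  rewrite fE !eqSS !(inj_eq double_inj) !gtn_eqF ?(leq_trans _ Ju)//.
  by rewrite !addr0 subr_eq0.
apply: (@absl_geV _ i.*2.+1).
  by rewrite (leq_trans _ (leq_addr _ _))// ltn_double.
rewrite fE !eqSS !(inj_eq double_inj) eqxx (negPf ij) addr0.
have -> : lambda_seq a i.*2.+1 = lambda_seq b i.*2.+1.
  rewrite -[i.*2.+1]mul1n -(expn0 2) !lambda_seqE; apply: eq_bigr => z zZ.
  by have := ab z; rewrite zZ /= negbK => /eqP ->.
by rewrite addrAC subrr add0r oner_eq0.
Qed.

Lemma translate_I_q a i : I_q R F (lambda_series R a + spike i).
Proof.
move=> [n|n] // _; rewrite coeflD /=; first by rewrite add0r.
Qed.

Lemma translate_E_qt a i : (forall k z, z \in Z -> a k z != 0) ->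
  E_qt R F (lambda_series R a + spike i).
Proof.
move=> a0; split; first exact: translate_I_q.
apply: lt_le_trans (@m_t_lambda_ge R F q_odd a i.*2.+1 _ a0 _).
  by rewrite invr_gt0 exprn_gt0// card_gt0.
move=> n ni; rewrite {1}/tail_coef coeflD -/(tail_coef _ _).
rewrite -[X in _ + X]/(tail_coef (spike i) n) tail_coef_spike gtn_eqF//.
by rewrite addr0 tail_coef_lambda_series.
Qed.

End Separation.
(** * Covers of a space of words by cylinders *)

Section CylinderCovers.
Local Open Scope ereal_scope.
Variables (R : realType) (A : finType) (center : nat -> nat -> A)
  (lev : nat -> nat).
Local Notation N := (#|A|%:R : R).

(** Cylinder i consists of the words agreeing with center i below lev i; it is
    charged to the node s only if it is contained in the cylinder of s. *)
Definition cylinder_weight (s : seq A) (i : nat) : \bar R :=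
  if (size s <= lev i)%N && (s == mkseq (center i) (size s))
  then (N ^- lev i)%:E else 0.

Definition node_weight s := \sum_(i <oo) cylinder_weight s i.

Let N_gt0 : (0 < N)%R.
Proof. by rewrite ltr0n; apply/card_gt0P; exists (center 0 0). Qed.

Lemma cylinder_weight_ge0 s i : 0 <= cylinder_weight s i.
Proof.
by rewrite /cylinder_weight; case: ifP => // _;
  rewrite lee_fin invr_ge0 exprn_ge0// ltW.
Qed.

Lemma sum_cylinder_weight_children s i :
  \sum_(x : A) cylinder_weight (rcons s x) i <= cylinder_weight s i.
Proof.
rewrite (bigD1 (center i (size s)))//= [X in _ + X]big1 ?adde0.
  rewrite /cylinder_weight size_rcons mkseqS eqseq_rcons eqxx andbT.
  case: ifP => [/andP[/ltnW -> ->]//|_].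
  exact: (cylinder_weight_ge0 s i).
move=> x /negPf xc; rewrite /cylinder_weight size_rcons mkseqS eqseq_rcons.
by rewrite xc !andbF.
Qed.

Lemma light_child s : node_weight s < (N ^- size s)%:E ->
  exists x, node_weight (rcons s x) < (N ^- (size s).+1)%:E.
Proof.
move=> ws; apply/existsP; move: ws; apply: contraTT => /existsPn /= wx.
rewrite -leNgt; apply: (@le_trans _ _ (\sum_(x : A) node_weight (rcons s x))).
  apply: (@le_trans _ _ (\sum_(x : A) (N ^- (size s).+1)%:E)); last first.
    by apply: lee_sum => x _; rewrite leNgt.
  rewrite sumEFin lee_fin sumr_const -[leRHS]mulr_natr exprS invfM.
  by rewrite mulrAC mulVf ?mul1r// gt_eqF.
rewrite /node_weight -nneseries_sum; last by move=> *; exact: cylinder_weight_ge0.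
apply: lee_nneseries => [i _ _|i _]; last exact: sum_cylinder_weight_children.
by apply: sume_ge0 => x _; exact: cylinder_weight_ge0.
Qed.

(** A greedy branch: as long as the cylinders below a node weigh less than the
    node, so do those below one of its children. If the total were less than 1,
    the infinite word obtained in this way would lie in no cylinder of the
    cover. *)
Lemma cylinder_cover_weight :
  (forall w : nat -> A, exists i, forall k, (k < lev i)%N -> w k = center i k) ->
  1 <= \sum_(i <oo) (N ^- lev i)%:E.
Proof.
move=> cover; rewrite leNgt; apply/negP => lt1.
have /boolp.choice[next nextP] : forall s, exists x,
    node_weight s < (N ^- size s)%:E ->
    node_weight (rcons s x) < (N ^- (size s).+1)%:E.
  move=> s; have [/light_child[x]|ws] := boolP (node_weight s < (N ^- size s)%:E).
    by exists x.
  by exists (center 0 0).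
pose node n := iter n (fun s => rcons s (next s)) [::].
pose w n := next (node n).
have nodeE n : node n = mkseq w n.
  by elim: n => // n IHn; rewrite mkseqS -IHn.
have light n : node_weight (node n) < (N ^- n)%:E.
  have sz m : size (node m) = m by rewrite nodeE size_mkseq.
  elim: n => [|n IHn].
    rewrite expr0 invr1; apply: le_lt_trans lt1.
    apply: lee_nneseries => [i _ _|i _].
      exact: cylinder_weight_ge0.
    by rewrite /cylinder_weight eqxx.
  by have := nextP (node n); rewrite sz; exact.
have [i wi] := cover w; have := light (lev i); rewrite ltNge => /negP; apply.
apply: (@le_trans _ _ (cylinder_weight (node (lev i)) i)).
  rewrite /cylinder_weight nodeE size_mkseq leqnn /=.
  rewrite ifT//; apply/eqP/eq_in_map => k; rewrite mem_iota add0n => /andP[_].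
  exact: wi.
rewrite /node_weight (nneseriesD1 (n := i)) ?leeDl ?nneseries_ge0//;
  by move=> *; exact: cylinder_weight_ge0.
Qed.

End CylinderCovers.
(** * Hausdorff measures *)

Section HausdorffMeasure.
Local Open Scope ereal_scope.
Variables (R : realType) (T : metricType R).
Implicit Types (U E : set T) (h : R -> R) (delta : R).

Lemma diam_ge0 U : 0 <= diam U.
Proof. by rewrite /diam le_max lexx. Qed.

Lemma mdist_le_diam U x y : U x -> U y -> (mdist x y)%:E <= diam U.
Proof.
move=> Ux Uy; rewrite /diam le_max; apply/orP; right.
by apply: ereal_sup_ubound; exists (x, y).
Qed.

Lemma diam_le U (r : R) : (0 <= r)%R ->
  (forall x y, U x -> U y -> (mdist x y <= r)%R) -> diam U <= r%:E.
Proof.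
move=> r0 Ur; rewrite /diam ge_max lee_fin r0; apply: ge_ereal_sup.
by move=> _ [[x y] [Ux Uy] <-]; rewrite lee_fin; exact: Ur.
Qed.

Lemma diam0 : diam (set0 : set T) = 0.
Proof. by apply/eqP; rewrite eq_le diam_ge0 andbT diam_le. Qed.

Lemma fine_diam_ge0 U : (0 <= fine (diam U))%R.
Proof. by rewrite fine_ge0// diam_ge0. Qed.

Lemma fine_diam_le U (r : R) : diam U <= r%:E -> (fine (diam U) <= r)%R.
Proof.
by have := diam_ge0 U; case: (diam U).
Qed.

Lemma mdist_le_fine_diam U (r : R) x y : diam U <= r%:E -> U x -> U y ->
  (mdist x y <= fine (diam U))%R.
Proof.
move=> Ur Ux Uy; have := mdist_le_diam Ux Uy; have := diam_ge0 U.
by case: (diam U) Ur => //= s _ _; rewrite lee_fin.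
Qed.

Lemma gauge_ge0 h (r : R) : gauge h -> (0 <= r)%R -> (0 <= h r)%R.
Proof.
move=> [_ _ h0 hpos]; rewrite le_eqVlt => /predU1P[<-|/hpos/ltW//].
by rewrite h0.
Qed.

Lemma gauge_le h (r s : R) : gauge h ->
  (0 <= r)%R -> (r <= s)%R -> (h r <= h s)%R.
Proof.
move=> [_ hle _ _] r0 rs; apply: hle => //; rewrite in_itv /= andbT//.
exact: le_trans rs.
Qed.

Lemma hausdorff_delta_ge h delta E m :
  (forall U : (set T)^nat, E `<=` \bigcup_i U i ->
     (forall i, diam (U i) <= delta%:E) ->
     m <= \sum_(i <oo) (h (fine (diam (U i))))%:E) ->
  m <= hausdorff_delta h delta E.
Proof.
by move=> mU; apply: le_ereal_inf_tmp => _ [U [EU Ud] <-]; exact: mU.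
Qed.

Lemma hausdorff_delta_le h delta E (U : (set T)^nat) : E `<=` \bigcup_i U i ->
  (forall i, diam (U i) <= delta%:E) ->
  hausdorff_delta h delta E <= \sum_(i <oo) (h (fine (diam (U i))))%:E.
Proof. by move=> EU Ud; apply: ereal_inf_lbound; exists U. Qed.

Lemma hausdorff_delta_mono h E delta delta' : (delta <= delta')%R ->
  hausdorff_delta h delta' E <= hausdorff_delta h delta E.
Proof.
move=> dd'; apply: hausdorff_delta_ge => U EU Ud.
by apply: hausdorff_delta_le => // i; apply: le_trans (Ud i) _; rewrite lee_fin.
Qed.

Lemma hausdorff_delta_subset h E E' delta : E `<=` E' ->
  hausdorff_delta h delta E <= hausdorff_delta h delta E'.
Proof.
move=> EE'; apply: hausdorff_delta_ge => U EU Ud.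
by apply: hausdorff_delta_le => //; exact: subset_trans EU.
Qed.

Lemma hausdorff_measureE h E : hausdorff_measure h E =
  ereal_sup [set hausdorff_delta h delta E | delta in [set` `]0%R, +oo[]].
Proof.
apply: cvg_lim => //; apply: nonincreasing_at_right_cvge => //.
by move=> d d' _ _ dd'; exact: hausdorff_delta_mono.
Qed.

Lemma hausdorff_delta_le_measure h E delta : (0 < delta)%R ->
  hausdorff_delta h delta E <= hausdorff_measure h E.
Proof.
move=> d0; rewrite hausdorff_measureE; apply: ereal_sup_ubound.
by exists delta => //=; rewrite in_itv /= d0.
Qed.

Lemma hausdorff_measure_le h E M :
  (forall delta, (0 < delta)%R -> hausdorff_delta h delta E <= M) ->
  hausdorff_measure h E <= M.
Proof.
move=> dM; rewrite hausdorff_measureE; apply: ge_ereal_sup => _ [d /= d0 <-].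
by apply: dM; move: d0; rewrite in_itv /= andbT.
Qed.

Lemma hausdorff_delta_gauge_le h h' E delta : gauge h ->
  (forall r : R, (0 <= r <= delta)%R -> (h r <= h' r)%R) ->
  hausdorff_delta h delta E <= hausdorff_delta h' delta E.
Proof.
move=> hg hh'; apply: hausdorff_delta_ge => U EU Ud.
apply: (le_trans (hausdorff_delta_le h EU Ud)).
apply: lee_nneseries => [i _ _|i _].
  by rewrite lee_fin gauge_ge0// fine_diam_ge0.
by rewrite lee_fin hh'// fine_diam_ge0 fine_diam_le.
Qed.

(** A set of diameter at most delta meets at most one of E and E', so a cover of
    the union splits into a cover of E and one of E'. *)
Lemma hausdorff_delta_separated h E E' delta : gauge h ->
  (forall x y, E x -> E' y -> (delta < mdist x y)%R) ->
  hausdorff_delta h delta E + hausdorff_delta h delta E' <=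
  hausdorff_delta h delta (E `|` E').
Proof.
move=> hg sep; have [_ _ h0 _] := hg; apply: hausdorff_delta_ge => U EU Ud.
pose V i := if pselect (exists2 x, U i x & E x) then U i else set0.
pose V' i := if pselect (exists2 x, U i x & E x) then set0 else U i.
have Vd i : diam (V i) <= delta%:E.
  rewrite /V; case: pselect => _ /=; first exact: Ud. rewrite diam0.
  by apply: le_trans (Ud i); exact: diam_ge0.
have V'd i : diam (V' i) <= delta%:E.
  rewrite /V'; case: pselect => _ /=; last exact: Ud. rewrite diam0.
  by apply: le_trans (Ud i); exact: diam_ge0.
have EV : E `<=` \bigcup_i V i.
  move=> x Ex; have [|i _ Uix] := EU x; first by left.
  exists i => //; rewrite /V; case: pselect => [_ |[]] /=; [exact: Uix | by exists x].
have E'V' : E' `<=` \bigcup_i V' i.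
  move=> y Ey; have [|i _ Uiy] := EU y; first by right.
  exists i => //; rewrite /V'; case: pselect => [[x Uix Ex] | _] /=; last exact: Uiy.
  have := le_trans (mdist_le_diam Uix Uiy) (Ud i).
  by rewrite lee_fin leNgt sep.
have hV0 (W : (set T)^nat) i : 0 <= (h (fine (diam (W i))))%:E.
  by rewrite lee_fin gauge_ge0// fine_diam_ge0.
apply: le_trans (leeD (hausdorff_delta_le h EV Vd) (hausdorff_delta_le h E'V' V'd)) _.
rewrite -nneseriesD//; apply: lee_nneseries => [i _ _|i _].
  by rewrite adde_ge0.
by rewrite /V /V'; case: pselect => _ /=; rewrite diam0 /= h0 ?adde0 ?add0e.
Qed.

Lemma hausdorff_delta_bigcup h (E : nat -> set T) delta (m : R) n : gauge h ->
  (forall i, m%:E <= hausdorff_delta h delta (E i)) ->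
  (forall i j x y, (i < n)%N -> (j < n)%N -> i != j -> E i x -> E j y ->
    (delta < mdist x y)%R) ->
  (m *+ n)%:E <= hausdorff_delta h delta (\bigcup_(i < n) E i).
Proof.
move=> hg Em; elim: n => [|n IHn] sep.
  rewrite mulr0n; apply: hausdorff_delta_ge => U _ _.
  by apply: nneseries_ge0 => i _ _; rewrite lee_fin gauge_ge0// fine_diam_ge0.
rewrite bigcup_mkord big_ord_recr /= -bigcup_mkord.
apply: le_trans (hausdorff_delta_separated hg _); last first.
  move=> x y [i /= ni Eix] Eny; apply: sep Eix Eny => //.
    by rewrite ltnW.
  by rewrite ltn_eqF.
rewrite mulrSr EFinD; apply: leeD => //.
by apply: IHn => i j x y ni nj; apply: sep; exact: ltnW.
Qed.

End HausdorffMeasure.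

(** * Images of a space of words *)

Section SymbolicImages.
Local Open Scope ereal_scope.
Variables (R : realType) (T : metricType R) (A : finType) (g : (nat -> A) -> T).
Variables (h : R -> R) (delta : R).
Hypotheses (A_gt1 : (1 < #|A|)%N) (hg : gauge h).
Local Notation N := (#|A|%:R : R).

(** Each set U of a cover lies, as far as the image of g is concerned, in a
    cylinder of level m with c * N^-m <= h (diam U), where m is the least index
    with s m <= diam U. Sets of diameter 0 have gauge 0 and may lie in cylinders
    of every level, whence an arbitrarily small error term. *)
Lemma hausdorff_delta_symbolic_ge (c : R) (s : nat -> R) :
  (forall n, 0 < s n)%R -> (forall e, 0 < e -> exists n, s n <= e)%R ->
  (forall w w' n k, (k <= n)%N -> w k != w' k ->
    (s n <= mdist (g w) (g w'))%R) ->
  (delta < s 0%N)%R ->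
  (forall n, (s n <= delta)%R -> (c * N ^- n <= h (s n))%R) -> (0 <= c)%R ->
  c%:E <= hausdorff_delta h delta (range g).
Proof.
move=> s0 s_small sep ds0 hs c0; apply: hausdorff_delta_ge => U gU Ud.
have N0 : (0 < N)%R by rewrite ltr0n ltnW.
have small (e : R) : (0 < e)%R -> exists n, (c * N ^- n <= e)%R.
  move=> e0; have e'0 : (0 < e / (c + 1))%R by rewrite divr_gt0// ltr_wpDl.
  have NV : (0 <= N^-1 < 1)%R by rewrite invr_ge0 ltW//= invf_lt1// ltr1n.
  have [n _ /(_ n (leqnn n)) /= nN] := expr_lt_near NV e'0.
  exists n; rewrite -exprVn; apply: (@le_trans _ _ (c * (e / (c + 1))))%R.
    by apply: ler_wpM2l => //; exact: ltW.
  by rewrite mulrCA ler_piMr 1?ltW// -?mulrA ltr_pdivrMr ?mul1r; lra.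
have [x0 _] : exists x : A, true by have /card_gt0P[x] := ltnW A_gt1; exists x.
have cyl (e : R) i : (0 < e)%R -> exists vn : (nat -> A) * nat,
    (forall w, U i (g w) -> forall k, (k < vn.2)%N -> w k = vn.1 k) /\
    (c * N ^- vn.2 <= h (fine (diam (U i))) + e)%R.
  move=> e0; set D := fine (diam (U i)).
  have [n nN] := small e e0.
  have hD : (0 <= h D)%R by rewrite gauge_ge0// fine_diam_ge0.
  have [[w0 Uw0]|noU] := pselect (exists w, U i (g w)); last first.
    exists (fun=> x0, n); split; last by rewrite ler_wpDl.
    by move=> w Uw; case: noU; exists w.
  have dist_le w : U i (g w) -> (mdist (g w) (g w0) <= D)%R.
    by move=> Uw; exact: mdist_le_fine_diam (Ud i) _ _.
  have := fine_diam_ge0 (U i); rewrite -/D le_eqVlt => /predU1P[D0|D0].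
    exists (w0, n); split; last by rewrite ler_wpDl.
    move=> w Uw k _; apply/eqP/negPn/negP => wk.
    have := le_trans (sep _ _ k k (leqnn k) wk) (dist_le w Uw).
    by rewrite leNgt -D0 s0.
  have ex_m : exists m, (s m <= D)%R by exact: s_small.
  case: (ex_minnP ex_m) => m mD mmin.
  have Dd : (D <= delta)%R by exact: fine_diam_le.
  exists (w0, m) => /=; split.
    move=> w Uw k km; apply/eqP/negPn/negP => wk.
    have km1 : (k <= m.-1)%N by move: km; case: (m).
    have := mmin m.-1 (le_trans (sep _ _ _ _ km1 wk) (dist_le w Uw)).
    by rewrite leqNgt; move: km; case: (m) => // m' _; rewrite ltnSn.
  apply: ler_wpDr; first exact: ltW.
  by apply: le_trans (hs m (le_trans mD Dd)) _; apply: gauge_le => //; exact: ltW.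
apply/lee_addgt0Pr => e e0.
have /boolp.choice[vn vnP] : forall i, exists vn : (nat -> A) * nat,
    (forall w, U i (g w) -> forall k, (k < vn.2)%N -> w k = vn.1 k) /\
    (c * N ^- vn.2 <= h (fine (diam (U i))) + e / (2 ^ i.+1)%:R)%R.
  by move=> i; apply: cyl; rewrite divr_gt0// ltr0n expn_gt0.
have := @cylinder_cover_weight R A (fun i => (vn i).1) (fun i => (vn i).2).
have cover (w : nat -> A) : exists i, forall k,
    (k < (vn i).2)%N -> w k = (vn i).1 k.
  have [|i _ Ui] := gU (g w); first by exists w.
  by exists i; exact: (vnP i).1.
move=> /(_ cover) one_le.
have h0 i : 0 <= (h (fine (diam (U i))))%:E.
  by rewrite lee_fin gauge_ge0// fine_diam_ge0.
apply: le_trans (epsilon_trick _ h0 (ltW e0)).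
rewrite -[c%:E]mule1;
apply: (@le_trans _ _ (c%:E * \sum_(i <oo) (N ^- (vn i).2)%:E)).
  by rewrite lee_wpmul2l.
rewrite -nneseriesZl; last by move=> i _; rewrite lee_fin invr_ge0 exprn_ge0// ltW.
apply: lee_nneseries => [i _ _|i _].
  by rewrite -EFinM lee_fin mulr_ge0// invr_ge0 exprn_ge0// ltW.
by rewrite -EFinM -EFinD lee_fin; exact: (vnP i).2.
Qed.

Lemma hausdorff_delta_symbolic_le (r : R) n : (0 <= r)%R -> (r <= delta)%R ->
  (forall w w', (forall k, (k < n)%N -> w k = w' k) ->
    (mdist (g w) (g w') <= r)%R) ->
  hausdorff_delta h delta (range g) <= (h r *+ #|A| ^ n)%:E.
Proof.
move=> r0 rd gr; have [_ _ h0 _] := hg.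
pose M := #|{ffun 'I_n -> A}|.
have ME : M = (#|A| ^ n)%N by rewrite /M card_ffun card_ord.
pose U (i : nat) : set T := [set x | exists2 j : 'I_M, val j = i &
  exists2 w : nat -> A, (forall k : 'I_n, w k = (enum_val j) k) & g w = x].
have U0 i : (M <= i)%N -> U i = set0.
  move=> Mi; apply/seteqP; split=> // x [j ji].
  by move: Mi; rewrite -ji leqNgt ltn_ord.
have Ur i : diam (U i) <= r%:E.
  apply: diam_le => // _ _ [j ji [w wj <-]] [j' j'i [w' w'j <-]].
  apply: gr => k kn; have jj' : j = j' by apply: val_inj; rewrite ji j'i.
  by rewrite (wj (Ordinal kn)) (w'j (Ordinal kn)) jj'.
have gU : range g `<=` \bigcup_i U i.
  move=> _ [w _ <-]; pose f := [ffun k : 'I_n => w k].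
  exists (enum_rank f) => //; exists (enum_rank f) => //; exists w => // k.
  by rewrite enum_rankK ffunE.
apply: le_trans (hausdorff_delta_le h gU _) _.
  by move=> i; apply: le_trans (Ur i) _; rewrite lee_fin.
have hU0 i : 0 <= (h (fine (diam (U i))))%:E.
  by rewrite lee_fin gauge_ge0// fine_diam_ge0.
rewrite (nneseries_split 0 M); last by move=> *; exact: hU0.
rewrite [X in _ + X]eseries0 ?adde0; last first.
  by move=> i; rewrite add0n => Mi _; rewrite U0// diam0 h0.
rewrite add0n -ME -[X in (_ *+ X)%R](card_ord M) -sumr_const big_mkord -sumEFin.
apply: lee_sum => i _; rewrite lee_fin; apply: gauge_le => //.
  exact: fine_diam_ge0.
exact: fine_diam_le.
Qed.

End SymbolicImages.
(** * The measure of C_q and of its translates *)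

Section Alphabet.
Variables (R : realType) (F : finFieldType).
Hypothesis q_odd : odd #|F|.
Local Notation q := (#|F|%:R : R).
Local Notation q' := (#|F|.-1).
Local Notation d := (#|F|.-1)./2.
Local Notation Z := (nonresidues F).

Lemma pred_card_gt1 : (1 < q')%N.
Proof.
rewrite [q'](card_pred_double q_odd) -[2%N]/(1.*2)%N leq_double.
exact: half_card_gt0.
Qed.

Lemma pred_card_gt0 : (0 < q')%N.
Proof. exact: ltnW pred_card_gt1. Qed.

(** The entries of a collection on one level. Only the indices in Z matter, so
    that the number of letters is exactly (q-1)^d. *)
Definition letter : finType := {ffun {z : F | z \in Z} -> {x : F | x != 0}}.

Lemma card_letter : #|letter| = (q' ^ d)%N.
Proof.
by rewrite card_ffun !card_sig card_nonresidues// -(cardC1 (0 : F)).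
Qed.

Lemma card_letter_gt1 : (1 < #|letter|)%N.
Proof.
have d0 := half_card_gt0 q_odd.
by rewrite card_letter -[1%N](exp1n d) ltn_exp2r// pred_card_gt1.
Qed.

Definition coef_of_word (w : nat -> letter) (k : nat) (z : F) : F :=
  if insub z is Some y then val (w k y) else 0.

Lemma coef_of_word_neq0 w k z : z \in Z -> coef_of_word w k z != 0.
Proof.
by move=> zZ; rewrite /coef_of_word insubT; case: (w k _).
Qed.

Lemma coef_of_word_inj w w' k : w k != w' k ->
  exists2 z, z \in Z & coef_of_word w k z != coef_of_word w' k z.
Proof.
move=> ww'; have /existsP[y wy] : [exists y, w k y != w' k y].
  apply: contraNT ww' => /existsPn ww'; apply/eqP/ffunP => y.
  exact/eqP/negPn/ww'.
exists (val y); first exact: valP.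
by rewrite /coef_of_word valK.
Qed.

Definition word_series (e : laurent_space R F) (w : nat -> letter) :
  laurent_space R F := lambda_series R (coef_of_word w) + e.

Lemma C_q_word_series : C_q R F = range (word_series 0).
Proof.
apply/seteqP; split=> [_ [a a0 <-]|_ [w _ <-]]; last first.
  exists (coef_of_word w).
    by move=> k z zZ; exact: coef_of_word_neq0.
  by rewrite Lambda_series /word_series addr0.
have a1 k (y : {z : F | z \in Z}) : a k (val y) != 0 by apply: a0; exact: valP.
exists (fun k => [ffun y => Sub (a k (val y)) (a1 k y)]) => //.
rewrite Lambda_series /word_series addr0.
apply: laurentP => -[n|n] //=; apply: (@eq_lambda_seq _ _ _ n.+1).
  by move=> k z zZ _; rewrite /coef_of_word insubT ffunE.
exact: ltn_expl.
Qed.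

Lemma mdist_translate (e f g : laurent_space R F) :
  mdist (f + e) (g + e) = absl R (f - g).
Proof.
congr absl; apply: laurentP => n; rewrite !coeflB !coeflD.
by rewrite opprD addrACA subrr addr0.
Qed.

Lemma mdist_word_series_ge e w w' n k : (k <= n)%N -> w k != w' k ->
  q ^- (2 ^ n * q') <= mdist (word_series e w) (word_series e w').
Proof.
move=> kn /coef_of_word_inj[z zZ zw]; rewrite mdist_translate.
apply: le_trans (absl_lambda_series_ge R q_odd zZ zw).
rewrite lef_pV2 ?posrE ?exprn_gt0 ?card_gt0// ler_eXn2l ?card_gt1//.
by rewrite leq_mul2r leq_exp2l// kn orbT.
Qed.

Lemma mdist_word_series_le e w w' n : (forall k, (k < n)%N -> w k = w' k) ->
  mdist (word_series e w) (word_series e w') <= q ^- (2 ^ n).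
Proof.
move=> ww'; rewrite mdist_translate.
apply: absl_lambda_series_le => k z _ kn.
by rewrite /coef_of_word ww'.
Qed.

Lemma A_q_gt0 : 0 < A_q R F.
Proof.
by rewrite /A_q mulr_gt0 ?divr_gt0 ?ln_gt0 ?ltr0n ?ltr1n ?pred_card_gt0 ?pred_card_gt1.
Qed.

Lemma powR_two_A_q : 2 `^ A_q R F = #|letter|%:R :> R.
Proof.
have q'E : q'%:R / 2 = d%:R :> R.
  by rewrite {1}(card_pred_double q_odd) -muln2 natrM mulfK// pnatr_eq0.
rewrite /powR pnatr_eq0 /= /A_q q'E mulrA mulfVK; last first.
  by rewrite gt_eqF// ln_gt0// ltr1n.
have q'0 : 0 < q'%:R :> R by rewrite ltr0n pred_card_gt0.
by rewrite card_letter natrX mulr_natl -lnXn// lnK// posrE exprn_gt0.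
Qed.

Lemma ln_card_gt0 : 0 < ln q.
Proof. by rewrite ln_gt0// card_gt1. Qed.

(** As 2 `^ A_q is the number N of letters, the gauge of q^-(2^n m) is N^-n up
    to a constant: logarithmic gauges turn doubly exponential radii into
    geometric weights. *)
Lemma log_gauge_geometric (h : R -> R) n m : (0 < m)%N ->
  log_gauge (A_q R F) h -> q ^- (2 ^ n * m) < expR (- 1) ->
  h (q ^- (2 ^ n * m)) = ((m%:R * ln q) `^ A_q R F)^-1 * #|letter|%:R ^- n.
Proof.
move=> m0 [_ hE] small; have q0 := card_gt0 R F.
rewrite hE; last by rewrite small invr_gt0 exprn_gt0.
rewrite !div1r invrK lnXn// -[ln _ *+ _]mulr_natl natrM -mulrA natrX.
rewrite powRM ?exprn_ge0 ?mulr_ge0 ?ler0n ?(ltW ln_card_gt0)//.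
rewrite -(powR_mulrn n (ler0n R 2)) -powRrM [n%:R * _]mulrC powRrM.
rewrite powR_mulrn ?powR_ge0//.
by rewrite powR_two_A_q invfM mulrC.
Qed.

Definition mass_const : R := ((q'%:R * ln q) `^ A_q R F)^-1.

Lemma mass_const_gt0 : 0 < mass_const.
Proof.
by rewrite invr_gt0 powR_gt0// mulr_gt0 ?ln_card_gt0 ?ltr0n ?pred_card_gt0.
Qed.

Lemma qV_small (e : R) : 0 < e -> exists n, q ^- n < e.
Proof.
move=> e0; have qV : 0 <= q^-1 < 1.
  by rewrite invr_ge0 ltW ?card_gt0//= invf_lt1 ?card_gt0// card_gt1.
have [n _ /(_ n (leqnn n)) /= qn] := expr_lt_near qV e0.
by exists n; rewrite -exprVn.
Qed.

Lemma qV_le m n : (m <= n)%N -> q ^- n <= q ^- m.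
Proof.
by move=> mn; rewrite lef_pV2 ?posrE ?exprn_gt0 ?card_gt0// ler_eXn2l ?card_gt1.
Qed.

Lemma hausdorff_delta_word_series_ge (h : R -> R) e delta :
  log_gauge (A_q R F) h -> delta < q ^- q' -> delta < expR (- 1) ->
  (mass_const%:E <= hausdorff_delta h delta (range (word_series e)))%E.
Proof.
move=> lh dq de; have [hg _] := lh.
have q'0 := pred_card_gt0.
apply: (@hausdorff_delta_symbolic_ge _ _ _ _ _ _ card_letter_gt1 hg _
  (fun n => q ^- (2 ^ n * q'))).
- by move=> n; rewrite invr_gt0 exprn_gt0 ?card_gt0.
- move=> r r0; have [n nr] := qV_small r0; exists n; apply: le_trans (ltW nr).
  apply: qV_le; apply: leq_trans (ltnW (ltn_expl n (isT : 1 < 2)%N)) _.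
  by rewrite leq_pmulr.
- by move=> w w' n k; exact: mdist_word_series_ge.
- by rewrite expn0 mul1n.
- move=> n nd; rewrite log_gauge_geometric//.
  exact: le_lt_trans de.
- exact/ltW/mass_const_gt0.
Qed.

Lemma hausdorff_delta_word_series_le (h : R -> R) e delta :
  log_gauge (A_q R F) h -> 0 < delta ->
  (hausdorff_delta h delta (range (word_series e)) <=
   ((ln q `^ A_q R F)^-1)%:E)%E.
Proof.
move=> lh d0; have [hg _] := lh.
have [n] : exists n, q ^- n < Num.min delta (expR (- 1)).
  by apply: qV_small; rewrite lt_min d0 expR_gt0.
rewrite lt_min => /andP[nd ne].
have n2 : q ^- (2 ^ n) <= q ^- n by apply: qV_le; exact/ltnW/ltn_expl.
have r0 : 0 <= q ^- (2 ^ n) by rewrite invr_ge0 exprn_ge0// ltW// card_gt0.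
apply: le_trans (hausdorff_delta_symbolic_le hg r0 (le_trans n2 (ltW nd))
  (fun w w' => @mdist_word_series_le e w w' n)) _.
rewrite lee_fin -{1}[(2 ^ n)%N]muln1 log_gauge_geometric//; last first.
  by rewrite muln1; exact: le_lt_trans ne.
rewrite mul1r -[leLHS]mulr_natr natrX mulfVK// expf_neq0// pnatr_eq0 -lt0n.
exact: ltnW card_letter_gt1.
Qed.

(** Below e^-1 the logarithm of 1/r exceeds 1. *)
Lemma log_gauge_anti (h h' : R -> R) s s' (r : R) : s <= s' ->
  log_gauge s h -> log_gauge s' h' -> 0 <= r < expR (- 1) -> h' r <= h r.
Proof.
move=> ss' [[_ _ h0 _] hE] [[_ _ h'0 _] h'E] /andP[].
rewrite le_eqVlt => /predU1P[<- _|r0 re]; first by rewrite h0 h'0.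
rewrite hE ?r0// h'E ?r0// !div1r.
have L1 : 1 <= ln r^-1.
  by rewrite lnV ?posrE// lerNr -(expRK (-1)) ler_ln ?posrE ?expR_gt0// ltW.
have L0 : 0 < ln r^-1 by exact: lt_le_trans L1.
by rewrite lef_pV2 ?posrE ?powR_gt0// ler_powR.
Qed.

End Alphabet.

Theorem theorem3p2 (R : realType) (F : finFieldType) (h : R -> R -> R)
  (q_odd : odd #|F|) (h_log : forall s : R, 0 < s -> log_gauge s (h s)) :
  [/\ C_q R F `<=`
        [set Theta | I_q R F Theta /\ #|F|%:R ^- (2 * #|F|.-1) <= m_t Theta],
      [set Theta | I_q R F Theta /\ #|F|%:R ^- (2 * #|F|.-1) <= m_t Theta]
        `<=` E_qt R F,
      (0 < hausdorff_measure (h (A_q R F)) (C_q R F) < +oo)%E,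
      (forall A : R, 0 < A <= A_q R F ->
        hausdorff_measure (h A) (E_qt R F) = +oo%E) &
      ((A_q R F)%:E <= dim_log h (E_qt R F))%E].
Proof.
have Aq0 := A_q_gt0 R q_odd; have lhq := h_log _ Aq0.
have q0 := card_gt0 R F.
have infinite (A : R) : 0 < A <= A_q R F ->
    hausdorff_measure (h A) (E_qt R F) = +oo%E.
  move=> /andP[A0 AAq]; apply/eqyP => B B0.
  have c0 := mass_const_gt0 R q_odd; set c := mass_const R F in c0.
  (* J.+1 separated translates, each of measure at least c, exceed B. *)
  pose J := Num.truncn (B / c).
  have BJ : B <= c *+ J.+1.
    by rewrite -mulr_natl -ler_pdivrMr// ltW// truncnS_gt.
  pose rho : R := Num.min (expR (- 1)) (#|F|%:R ^- (J.+1.*2 + #|F|.-1)).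
  have rho0 : 0 < rho by rewrite lt_min expR_gt0 invr_gt0 exprn_gt0.
  have d0 : 0 < rho / 2 by rewrite divr_gt0.
  have : rho / 2 < rho by rewrite ltr_pdivrMr// ltr_pMr// ltr1n.
  rewrite {2}/rho lt_min; set delta := rho / 2 in d0 * => /andP[de dJ].
  apply: (@le_trans _ _ (hausdorff_delta (h A) delta (E_qt R F)));
    last exact: hausdorff_delta_le_measure.
  pose E i := range (@word_series R F (spike R F i)).
  apply: (@le_trans _ _ (hausdorff_delta (h A) delta (\bigcup_(i < J.+1) E i))).
    apply: (@le_trans _ _ (c *+ J.+1)%:E); first by rewrite lee_fin.
    apply: hausdorff_delta_bigcup; first exact: (h_log A A0).1.
      move=> i; apply: (@le_trans _ _ (hausdorff_delta (h (A_q R F)) delta (E i))).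
        apply: hausdorff_delta_word_series_ge => //.
        by apply: lt_le_trans dJ _; apply: qV_le; rewrite leq_addl.
      apply: hausdorff_delta_gauge_le; first exact: lhq.1.
      move=> r /andP[r0 rd]; apply: log_gauge_anti AAq (h_log A A0) lhq _.
      by rewrite r0 (le_lt_trans rd de).
    move=> i j _ _ iJ jJ ij [w _ <-] [w' _ <-].
    by apply: lt_le_trans dJ _; exact: absl_translate_ge.
  apply: hausdorff_delta_subset => _ [i _ [w _ <-]].
  by apply: translate_E_qt => // k z zZ; exact: coef_of_word_neq0.
split=> //.
- rewrite C_q_word_series// => _ [w _ <-]; rewrite /word_series addr0; split.
    exact: lambda_series_I_q.
  have := @m_t_lambda_ge R F q_odd (coef_of_word w) 0.
  rewrite addn0; apply; first by move=> k z; exact: coef_of_word_neq0.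
  by move=> i _; exact: tail_coef_lambda_series.
- move=> Theta [IT mT]; split=> //; apply: lt_le_trans mT.
  by rewrite invr_gt0 exprn_gt0.
- rewrite C_q_word_series//; apply/andP; split; last first.
    apply: le_lt_trans (ltry (ln #|F|%:R `^ A_q R F)^-1).
    by apply: hausdorff_measure_le => delta; exact: hausdorff_delta_word_series_le.
  pose rho : R := Num.min (expR (- 1)) (#|F|%:R ^- #|F|.-1).
  have rho0 : 0 < rho by rewrite lt_min expR_gt0 invr_gt0 exprn_gt0.
  have d0 : 0 < rho / 2 by rewrite divr_gt0.
  have : rho / 2 < rho by rewrite ltr_pdivrMr// ltr_pMr// ltr1n.
  rewrite {2}/rho lt_min; set delta := rho / 2 in d0 * => /andP[de dJ].
  apply: (lt_le_trans _ (hausdorff_delta_le_measure _ _ d0)).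
  apply: (lt_le_trans _ (hausdorff_delta_word_series_ge q_odd _ lhq dJ de)).
  by rewrite lte_fin mass_const_gt0.
- apply: le_ereal_inf_tmp => _ [s [s0 sE] <-]; rewrite lee_fin leNgt.
  apply/negP => sA; have := infinite s; rewrite s0 ltW// sE => /(_ isT).
  by [].
Qed.
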